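(* For every positive integer $n$ there exists a positive constant $C(n)$ with the following property: for every $0<\delta\leq 1/2$ and every (Lebesgue) measurable set $A\subseteq[0,1]^2$ satisfying $|A|\geq\delta$ there is an interval $I(A,n)\subseteq(0,1]$ of length at least $\exp(-\delta^{-C(n)})$ such that for every $\lambda\in I(A,n)$ the set $A$ contains an isometric copy of the distance graph $\lambda\cdot\Gamma_n$.
   Context: $|A|$ denotes the two-dimensional Lebesgue measure of $A\subseteq\mathbb{R}^2$. $\Gamma_n$ denotes the distance graph given by the $1$-skeleton of an $n$-dimensional unit hypercube. For a real number $\lambda>0$, a set $A\subseteq\mathbb{R}^2$ is said to contain an isometric copy of $\lambda\cdot\Gamma_n$ if there exist a point $x\in\mathbb{R}^2$ and vectors $y_1,\ldots,y_n\in\mathbb{R}^2$, each of Euclidean length exactly $\lambda$, such that $x+r_1y_1+\cdots+r_ny_n\in A$ for all $2^n$ tuples $(r_1,\ldots,r_n)\in\{0,1\}^n$ and these $2^n$ points are mutually distinct. *)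

(* Defs.v *)
From HB Require Import structures.
From mathcomp Require Import all_boot all_order all_algebra.
From mathcomp Require Import all_classical all_reals all_analysis.

Set Implicit Arguments.
Unset Strict Implicit.
Unset Printing Implicit Defensive.

Import Order.TTheory GRing.Theory Num.Theory.
Import numFieldNormedType.Exports.

Local Open Scope classical_set_scope.
Local Open Scope ring_scope.

Section plane_lebesgue_measure.
Context {R : realType}.

(* The measurable sets of [\x] are the Borel sets of the plane; its completed
   extension, on the Caratheodory sigma-algebra of the induced outer measure,
   is the two-dimensional Lebesgue measure. *)
Definition lebesgue_measure2 : set (R * R) -> \bar R :=
  @completed_measure_extension _ _ _
    (@lebesgue_measure R \x @lebesgue_measure R)%E.

Definition lebesgue_measurable2 : set (set (R * R)) :=
  ((@lebesgue_measure R \x @lebesgue_measure R)%E^*)%mu.-cara.-measurable.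

End plane_lebesgue_measure.

Section hypercube_graph.
Context {R : realType}.

(* The canonical norm [`|y|] on [R * R] is the sup norm. *)
Definition euclidean_norm (y : R * R) : R := Num.sqrt (y.1 ^+ 2 + y.2 ^+ 2).

Definition cube_vertex n (x : R * R) (y : 'I_n -> R * R)
    (r : {ffun 'I_n -> bool}) : R * R :=
  x + \sum_(i < n) y i *+ r i.

Definition contains_hypercube_graph n (lambda : R) (A : set (R * R)) : Prop :=
  exists (x : R * R) (y : 'I_n -> R * R),
    [/\ forall i, euclidean_norm (y i) = lambda,
        forall r, A (cube_vertex x y r)
      & injective (cube_vertex x y)].

End hypercube_graph.

(* Main.v *)
Require Import Defs.
From HB Require Import structures.
From mathcomp Require Import all_boot all_order all_algebra.
From mathcomp Require Import all_classical all_reals all_analysis.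
From mathcomp Require Import ring lra zify.

(** Discretize: a closed subset of [A] of measure at least [delta / 2] is replaced
   by the set [S] of the lattice cells it meets, living in a finite torus, and
   configurations found at finer and finer mesh converge along an ultrafilter to a
   configuration in [A], with edges of length exactly [lambda].

   In the torus, let [N(s_1, .., s_n)] count the cubes in [S] whose [i]-th edge is
   distributed as [s_i].  If all the edges are distributed as the difference of two
   uniform points of a square of side [a], then [N] is at least a power of the
   density (iterated Cauchy-Schwarz), and it increases when [a] decreases to one of
   its divisors.  Hence among [delta ^ (- C)] squares with sides in geometric
   progression, there are two consecutive sides [a > b] between which [N] barely
   changes.  At the intermediate scale, an edge on a circle of radius [L] can be
   traded for a difference of points of the square of side [a]: by curvature, the
   correlation of any function along a thin arc is close to its correlation along
   an arc thickened to a small multiple of [L]; the thick arc is nearly invariant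
   under the translations of length at most [b]; and the kernel difference between
   the scales [b] and [a] is positive semidefinite, its total effect being bounded by
   the increment of [N]. *)

Set Implicit Arguments.
Unset Strict Implicit.
Unset Printing Implicit Defensive.

Import Order.TTheory GRing.Theory Num.Theory.
Import numFieldNormedType.Exports.

Local Open Scope ring_scope.

(** * Box forms on a finite abelian group *)

(** Thickening fails for arbitrary functions: an arc of height [k] is disjoint from its vertical
    translates by more than [k]. It holds for autocorrelations, because Cauchy-Schwarz replaces the
    arc by its set of differences, which is two-dimensional: at a fixed horizontal difference, the
    vertical ones advance in almost equal steps and hardly feel a vertical shift.

    Trading the thick arcs costs a factor polynomial in [k], since the other edges are compared with
    the large square only through a density bound. So [k] is fixed first, as a power of 1/delta that
    makes the arc errors small, and then the number [J] of scales, as a larger power that beats this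
    factor. The sides span a ratio [k ^ (8 * J)], whence the length exp(- delta ^ (- C)).

    The stable scale is chosen from the squares alone, so that it serves every radius between
    [k ^ 7 * b] and its double: this yields an interval. Edges are drawn from arcs over lacunary
    abscissae, not from the whole circle, so that the vertices stay distinct in the limit. *)

Section mean.
Context {R : realFieldType}.

Definition mean {T : Type} (s : seq T) (c : T -> R) : R :=
  (\sum_(y <- s) c y) / (size s)%:R.

Lemma eq_mean (T : Type) (s : seq T) (c d : T -> R) :
  c =1 d -> mean s c = mean s d.
Proof. by move=> e; rewrite /mean (eq_bigr d) // => i _; apply: e. Qed.

Lemma mean_const (T : Type) (s : seq T) (c : R) :
  (0 < size s)%N -> mean s (fun=> c) = c.
Proof.
move=> s0; rewrite /mean big_const_seq count_predT iter_addr addr0.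
by rewrite -[_ *+ _]mulr_natr mulfK // pnatr_eq0 -lt0n.
Qed.

Lemma meanD (T : Type) (s : seq T) (c d : T -> R) :
  mean s (fun y => c y + d y) = mean s c + mean s d.
Proof. by rewrite /mean big_split mulrDl. Qed.

Lemma meanN (T : Type) (s : seq T) (c : T -> R) :
  mean s (fun y => - c y) = - mean s c.
Proof. by rewrite /mean sumrN mulNr. Qed.

Lemma meanB (T : Type) (s : seq T) (c d : T -> R) :
  mean s (fun y => c y - d y) = mean s c - mean s d.
Proof. by rewrite meanD meanN. Qed.

Lemma meanZ (T : Type) (s : seq T) (a : R) (c : T -> R) :
  mean s (fun y => a * c y) = a * mean s c.
Proof. by rewrite /mean -mulr_sumr mulrA. Qed.

Lemma mean_allpairs (T1 T2 T : Type) (h : T1 -> T2 -> T) s t (c : T -> R) :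
  mean [seq h x y | x <- s, y <- t] c = mean s (fun x => mean t (fun y => c (h x y))).
Proof.
rewrite /mean big_allpairs_dep size_allpairs natrM invfM -mulr_suml.
by rewrite -[RHS]mulrA [X in _ = _ * X]mulrC.
Qed.

Lemma mean_exchange (T1 T2 : Type) (s : seq T1) (t : seq T2) (c : T1 -> T2 -> R) :
  mean s (fun x => mean t (c x)) = mean t (fun y => mean s (fun x => c x y)).
Proof.
rewrite /mean -!mulr_suml exchange_big -!mulrA; congr (_ * _).
by rewrite mulrC.
Qed.

Lemma mean_sum (T : Type) (I : finType) (s : seq T) (c : I -> T -> R) :
  mean s (fun y => \sum_i c i y) = \sum_i mean s (c i).
Proof. by rewrite /mean exchange_big mulr_suml. Qed.

Lemma ler_mean (T : eqType) (s : seq T) (c d : T -> R) :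
  (forall y, y \in s -> c y <= d y) -> mean s c <= mean s d.
Proof.
move=> cd; rewrite /mean ler_wpM2r ?invr_ge0 ?ler0n //.
by rewrite big_seq [leRHS]big_seq ler_sum.
Qed.

Lemma mean_ge0 (T : eqType) (s : seq T) (c : T -> R) :
  (forall y, y \in s -> 0 <= c y) -> 0 <= mean s c.
Proof.
move=> c0; rewrite /mean mulr_ge0 ?invr_ge0 ?ler0n //.
by rewrite big_seq sumr_ge0.
Qed.

Lemma mean_norm_le (T : eqType) (s : seq T) (c : T -> R) (M : R) :
  (0 < size s)%N -> (forall y, y \in s -> `|c y| <= M) -> `|mean s c| <= M.
Proof.
move=> s0 cM; rewrite -(mean_const M s0) ler_norml -meanN.
by apply/andP; split; apply: ler_mean => y /cM; rewrite ler_norml => /andP[].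
Qed.

Lemma mean_sqr_le (T : eqType) (s : seq T) (c : T -> R) :
  (0 < size s)%N -> mean s c ^+ 2 <= mean s (fun y => c y ^+ 2).
Proof.
move=> s0; rewrite -subr_ge0.
have -> : mean s (fun y => c y ^+ 2) - mean s c ^+ 2 =
    mean s (fun y => (c y - mean s c) ^+ 2).
  rewrite (@eq_mean _ _ (fun y => (c y - mean s c) ^+ 2)
    (fun y => c y ^+ 2 + ((- 2 * mean s c) * c y + mean s c ^+ 2))).
    by rewrite !meanD meanZ mean_const //; ring.
  by move=> y; ring.
by apply: mean_ge0 => y _; rewrite sqr_ge0.
Qed.

Lemma mean_gt0 (T : eqType) (s : seq T) (c : T -> R) :
  0 < mean s c -> exists2 y, y \in s & 0 < c y.
Proof.
move=> c0; apply/hasP; apply: contraLR c0 => /hasPn c0.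
rewrite -leNgt -oppr_ge0 -meanN mean_ge0 // => y /c0.
by rewrite -leNgt oppr_ge0.
Qed.

End mean.

(* A finite sequence [s : seq G] stands for the uniform probability on its terms,
   counted with multiplicity. *)
Section box.
Context {R : realFieldType} {G : finZmodType}.
Implicit Types (F H : G -> R) (s t : seq G) (ss : seq (seq G)).

Definition total F : R := \sum_x F x.
Definition corr F (z : G) : R := \sum_x F x * F (x + z).
Definition mulshift F (y x : G) : R := F x * F (x + y).

(** With [Phi := total] this sums the product of [F] over the vertices of a random cube. A general
    [Phi] allows one edge to be treated apart from the others. *)
Fixpoint box_mean ss (Phi : (G -> R) -> R) F : R :=
  if ss is s :: ss' then mean s (fun y => box_mean ss' Phi (mulshift F y))
  else Phi F.

(** Stable under [mulshift], so that a bound uniform over this class applies at every level of a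
    nested [box_mean]. *)
Definition admissible (m : R) F : Prop :=
  (forall x, 0 <= F x <= 1) /\ total F <= m.

Lemma admissible_mulshift m F y : admissible m F -> admissible m (mulshift F y).
Proof.
move=> [F01 Fm]; split => [x|].
  have /andP[a0 a1] := F01 x; have /andP[b0 b1] := F01 (x + y).
  by rewrite /mulshift mulr_ge0 // mulr_ile1.
apply: le_trans Fm; apply: ler_sum => x _; rewrite /mulshift.
have /andP[a0 a1] := F01 x; have /andP[b0 b1] := F01 (x + y).
by rewrite ler_piMr.
Qed.

Lemma sum_shift (F : G -> R) y : \sum_x F (x + y) = \sum_x F x.
Proof. by rewrite [RHS](reindex_inj (addIr y)). Qed.

Lemma corr_norm_le F z : `|corr F z| <= corr F 0.
Proof.
have E e : e ^+ 2 = 1 -> 0 <= 2 * corr F 0 + 2 * e * corr F z.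
  move=> e2.
  have -> : 2 * corr F 0 + 2 * e * corr F z = \sum_x (F x + e * F (x + z)) ^+ 2.
    have -> : \sum_x (F x + e * F (x + z)) ^+ 2 =
       \sum_x (F x * F x + 2 * e * (F x * F (x + z)) + F (x + z) * F (x + z)).
      apply: eq_bigr => x _.
      by transitivity (F x * F x + 2 * e * (F x * F (x + z)) + e ^+ 2 * (F (x + z) * F (x + z)));
        [ring|rewrite e2 mul1r].
    rewrite !big_split -mulr_sumr /= (sum_shift (fun x => F x * F x)) /corr.
    under [X in 2 * X + _]eq_bigr do rewrite addr0.
    ring.
  by apply: sumr_ge0 => x _; rewrite sqr_ge0.
have := E 1 (expr1n _ _); have := E (-1) (etrans (sqrrN _) (expr1n _ _)).
by move=> h1 h2; rewrite ler_norml; apply/andP; split; lra.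
Qed.

Lemma corr0_le m F : admissible m F -> corr F 0 <= m.
Proof.
move=> [F01 Fm]; apply: le_trans Fm; apply: ler_sum => x _.
by rewrite addr0; have /andP[a0 a1] := F01 x; rewrite ler_piMr.
Qed.


Lemma ler_box_mean ss (Phi Psi : (G -> R) -> R) m F :
  (forall F, admissible m F -> Phi F <= Psi F) -> admissible m F ->
  box_mean ss Phi F <= box_mean ss Psi F.
Proof.
move=> PP; elim: ss F => [|s ss IH] F Fm /=; first exact: PP.
by apply: ler_mean => y _; apply/IH/admissible_mulshift.
Qed.

Lemma box_mean_const ss F (c : R) :
  all (fun s => 0 < size s)%N ss -> box_mean ss (fun=> c) F = c.
Proof.
elim: ss F => [|s ss IH] F //= /andP[s0 /IH ss0].
by rewrite (eq_mean s (fun y => ss0 (mulshift F y))) mean_const.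
Qed.

Lemma box_meanB ss (Phi Psi : (G -> R) -> R) F :
  box_mean ss (fun F => Phi F - Psi F) F = box_mean ss Phi F - box_mean ss Psi F.
Proof.
elim: ss F => [|s ss IH] F //=.
by rewrite -meanB; apply: eq_mean => y; rewrite IH.
Qed.

Lemma box_mean_cat ss tt Phi F :
  box_mean (ss ++ tt) Phi F = box_mean ss (box_mean tt Phi) F.
Proof. by elim: ss F => //= s ss IH F; apply: eq_mean => y; exact: IH. Qed.

Lemma mulshiftC F y z : mulshift (mulshift F y) z = mulshift (mulshift F z) y.
Proof.
apply: funext => x; rewrite /mulshift -[x + z + y]addrA [z + y]addrC [x + (y + z)]addrA.
ring.
Qed.

Lemma box_mean_rot s ss Phi F :
  box_mean (s :: ss) Phi F = box_mean (ss ++ [:: s]) Phi F.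
Proof.
elim: ss F => //= t ss IH F; rewrite mean_exchange; apply: eq_mean => y.
rewrite -IH /=; apply: eq_mean => z; by rewrite mulshiftC.
Qed.

Definition box_form ss F : R := box_mean ss total F.

(** Rotating the chosen edge to the innermost place exposes it as a correlation, because
    [total (mulshift F y)] is [corr F y]. *)
Lemma box_form_cons s ss F :
  box_form (s :: ss) F = box_mean ss (fun F => mean s (corr F)) F.
Proof.
rewrite /box_form box_mean_rot box_mean_cat /=.
by [].
Qed.

(** Bounded density of one law with respect to another, in dual form. *)
Definition dominated (B : R) s t : Prop :=
  forall Phi : G -> R, (forall y, 0 <= Phi y) -> mean s Phi <= B * mean t Phi.

Lemma box_mean_ge0 ss (Phi : (G -> R) -> R) m F :
  (forall F, admissible m F -> 0 <= Phi F) -> admissible m F ->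
  0 <= box_mean ss Phi F.
Proof.
move=> P0; elim: ss F => [|s ss IH] F Fm /=; first exact: P0.
by apply: mean_ge0 => y _; apply/IH/admissible_mulshift.
Qed.

Lemma box_mean_dominated ss t (Phi : (G -> R) -> R) (B : R) m F :
  0 <= B ->
  (forall F, admissible m F -> 0 <= Phi F) -> admissible m F ->
  (forall s, s \in ss -> dominated B s t) ->
  box_mean ss Phi F <= B ^+ size ss * box_mean (nseq (size ss) t) Phi F.
Proof.
move=> B0 P0; elim: ss F => [|s ss IH] F Fm st /=; first by rewrite mul1r.
rewrite exprS -mulrA -meanZ.
apply: (@le_trans _ _ (mean s (fun y =>
    B ^+ size ss * box_mean (nseq (size ss) t) Phi (mulshift F y)))).
  apply: ler_mean => y _; apply: IH; first exact: admissible_mulshift.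
  by move=> u us; apply: st; rewrite inE us orbT.
apply: (st s (mem_head _ _)) => y; apply: mulr_ge0; first exact: exprn_ge0.
by apply: (box_mean_ge0 _ P0); apply: admissible_mulshift.
Qed.

(** Hybrid argument: the pairs are exchanged one at a time, and the exchanged entries pile up in
    [d]. The property [C] is what a step may assume of the other entries, whether already exchanged
    or not. *)
Lemma box_form_replace (C : seq G -> Prop) (n : nat) (K : R)
    (l : seq (seq G * seq G)) (d : seq (seq G)) F :
  (forall p, p \in l -> C p.1 /\ C p.2) -> (forall s, s \in d -> C s) ->
  (forall p ctx, p \in l -> (forall s, s \in ctx -> C s) -> (size ctx).+1 = n ->
    box_form (p.2 :: ctx) F - K <= box_form (p.1 :: ctx) F) ->
  (size l + size d)%N = n ->
  box_form (map snd l ++ d) F - (size l)%:R * K <= box_form (map fst l ++ d) F.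
Proof.
elim: l d => [|p l IH] d lC dC step n_eq; first by rewrite mul0r subr0.
rewrite [size _]/= -natr1 mulrDl mul1r opprD addrA.
have /(_ (map fst l ++ d)) := step p _ (mem_head _ _).
rewrite size_cat size_map => /(_ _ n_eq) hstep.
apply: le_trans (hstep _); last first.
  move=> s; rewrite mem_cat => /orP[|/dC//] /mapP[q ql ->].
  by have [] := lC q (mem_behead (s := p :: l) ql).
rewrite lerD2r.
have H ss : box_form ((p.2 :: ss) ++ d) F = box_form (ss ++ (d ++ [:: p.2])) F.
  by rewrite /box_form cat_cons box_mean_rot catA.
rewrite [map snd _]/= H -cat_cons H; apply: IH.
- by move=> q ql; apply: lC; rewrite inE ql orbT.
- move=> s; rewrite mem_cat inE => /orP[/dC//|/eqP ->].
  by have [] := lC p (mem_head _ _).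
- by move=> q ctx ql; apply: step; rewrite inE ql orbT.
- by rewrite size_cat addn1 addnS.
Qed.

(* All vectors are first thickened, each at a cost uniform in the other ones;
   only then is each thick vector traded for [P], because the price of this
   second exchange is controlled by [Pb - P] only once all the other vectors are
   spread out, i.e. dominated by [P]. *)
Lemma box_form_thin_ge (m B e1 e2 : R) (P Pb : seq G)
    (l : seq (seq G * seq G)) F :
  admissible m F -> 0 <= m -> 1 <= B -> 0 <= e1 -> 0 <= e2 ->
  (0 < size P)%N -> (0 < size Pb)%N ->
  (forall p, p \in l -> (0 < size p.1)%N /\ (0 < size p.2)%N) ->
  (forall H, mean P (corr H) <= mean Pb (corr H)) ->
  (forall p H, p \in l ->
    mean p.2 (corr H) - e1 * corr H 0 <= mean p.1 (corr H)) ->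
  (forall p H, p \in l ->
    mean P (corr H) - (mean Pb (corr H) - mean P (corr H)) - e2 * corr H 0
      <= mean p.2 (corr H)) ->
  (forall p, p \in l -> dominated B p.2 P) ->
  box_form (nseq (size l) P) F
    - (size l)%:R * ((e1 + e2) * m + B ^+ (size l).-1 *
       (box_form (nseq (size l) Pb) F - box_form (nseq (size l) P) F))
    <= box_form (map fst l) F.
Proof.
move=> Fm m0 B1 e10 e20 P0 Pb0 l0 PPb l1 l2 l3; set n := size l.
case: (posnP n) => [n0|n_gt0].
  by have -> : l = [::]; [exact/nilP/eqP|rewrite /= n0 mul0r subr0].
have B0 : 0 <= B by lra.
pose D H := mean Pb (corr H) - mean P (corr H).
have D0 H : admissible m H -> 0 <= D H by rewrite subr_ge0.
have corr_total H : admissible m H -> corr H 0 <= m by exact: corr0_le.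
have thin : box_form (map snd l ++ [::]) F - n%:R * (e1 * m) <= box_form (map fst l ++ [::]) F.
  apply: (@box_form_replace (fun s => 0 < size s)%N n) => //; last by rewrite addn0.
  move=> p ctx pl ctx0 _; rewrite !box_form_cons.
  rewrite -(@box_mean_const ctx F (e1 * m)); last by apply/allP.
  rewrite -box_meanB; apply: (@ler_box_mean _ _ _ m) => // H Hm.
  apply: le_trans (l1 p H pl); rewrite lerD2l lerN2.
  by rewrite ler_wpM2l // corr_total.
set E := B ^+ n.-1 * _.
(* The context of an exchange is dominated by [n.-1] copies of [P], which brings in the increment
   when a single [P] becomes [Pb]. Replacing the remaining copies as well only increases the form,
   so this is at most the increment of the full form. *)
have inc : box_form (Pb :: nseq n.-1 P) F <= box_form (nseq n Pb) F.
  have rotE Q : box_form (Pb :: nseq n.-1 Q) F = box_form (nseq n.-1 Q ++ [:: Pb]) F.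
    exact: box_mean_rot.
  have {2}-> : n = n.-1.+1 by rewrite prednK.
  rewrite [nseq _.+1 _]/= !rotE -(subr0 (box_form _ F)) -(mulr0 (size (nseq n.-1 (Pb, P)))%:R).
  have := @box_form_replace (fun s => 0 < size s)%N n 0
    (nseq n.-1 (Pb, P)) [:: Pb] F.
  rewrite !map_nseq; apply.
  - by move=> p /nseqP[->].
  - by move=> s; rewrite inE => /eqP ->.
  - move=> p ctx /nseqP[-> _] _ _; rewrite subr0 !box_form_cons.
    by apply: (@ler_box_mean _ _ _ m).
  - by rewrite size_nseq addn1 prednK.
have thick : box_form (map snd [seq (p.2, P) | p <- l] ++ [::]) F - n%:R * (e2 * m + E)
    <= box_form (map fst [seq (p.2, P) | p <- l] ++ [::]) F.
  have {1}-> : n = size [seq (p.2, P) | p <- l] by rewrite size_map.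
  (* The invariant is domination by [P]: a hypothesis for thick vectors, and true of [P] itself
     because [1 <= B]. *)
  apply: (@box_form_replace (fun s => (0 < size s)%N /\ dominated B s P) n) => //.
  - move=> q /mapP[p pl ->] /=; split; first by split; [have [] := l0 p pl|exact: l3].
    split=> // Phi Phi0; apply: ler_peMl => //; exact: mean_ge0.
  - move=> q ctx /mapP[p pl ->] ctx0 szc; rewrite !box_form_cons [_.2]/= [_.1]/=.
    have cn : size ctx = n.-1 by rewrite -szc.
    have ctxD : box_mean ctx D F <= E.
      apply: le_trans (box_mean_dominated B0 D0 Fm (fun s sc => (ctx0 s sc).2)) _.
      rewrite /E cn ler_wpM2l ?exprn_ge0 //.
      rewrite box_meanB -!box_form_cons.
      by rewrite -[X in _ - box_form (nseq X _) F](prednK n_gt0) lerD2r.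
    have ctxm : box_mean ctx (fun=> e2 * m) F = e2 * m.
      by rewrite box_mean_const //; apply/allP => s /ctx0[].
    rewrite opprD addrA -{1}ctxm -box_meanB.
    apply: le_trans (_ : box_mean ctx (fun F0 => (mean P (corr F0) - e2 * m) - D F0) F <= _).
      by rewrite [leRHS]box_meanB lerD2l lerN2.
    apply: (@ler_box_mean _ _ _ m) => // H Hm; apply: le_trans (l2 p H pl).
    have := corr_total H Hm; have : 0 <= e2 by []; rewrite /D.
    move=> e2' c; have := ler_wpM2l e2' c; lra.
  - by rewrite size_map addn0.
move: thick thin; rewrite !cats0 -!map_comp.
have -> : map (snd \o (fun p : seq G * seq G => (p.2, P))) l = nseq n P.
  by rewrite /n; elim: (l) => //= p l' ->.
rewrite (@eq_map _ _ (fst \o _) snd) // => thick thin.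
by apply: le_trans thin; apply: le_trans (lerB thick (lexx _)); rewrite !mulrDr; lra.
Qed.

Lemma total_ge0 F : (forall x, 0 <= F x) -> 0 <= total F.
Proof. by move=> F0; apply: sumr_ge0. Qed.

Fixpoint cube_prod (ys : seq G) F : G -> R :=
  if ys is y :: ys' then cube_prod ys' (mulshift F y) else F.

Lemma box_form_gt0 ss F : (forall x, 0 <= F x) -> 0 < box_form ss F ->
  exists ys : seq G, exists x, [/\ size ys = size ss,
    forall i, (i < size ss)%N -> nth 0 ys i \in nth [::] ss i &
    0 < cube_prod ys F x].
Proof.
elim: ss F => [|s ss IH] F F0 /= H.
  exists [::]; suff [x Fx] : exists x, 0 < F x by exists x.
  apply: contrapT => /forallNP nF; move: H; apply/negP; rewrite -leNgt.
  by apply: sumr_le0 => x _; rewrite leNgt; apply/negP/nF.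
have [y ys Hy] := mean_gt0 H.
have F0' x : 0 <= mulshift F y x by rewrite mulr_ge0.
have [ys' [x [sz mem pos]]] := IH _ F0' Hy.
exists (y :: ys'), x; split => //=; first by rewrite sz.
by case=> [|i] //=; exact: mem.
Qed.

Lemma cube_prod_gt0 ys F x : (forall x, 0 <= F x) -> 0 < cube_prod ys F x ->
  forall r : nat -> bool, 0 < F (x + \sum_(i < size ys) nth 0 ys i *+ r i).
Proof.
elim: ys F x => [|y ys IH] F x F0 /=.
  by move=> Fx r; rewrite big_ord0 addr0.
move=> /IH H r; have {}H : forall r : nat -> bool,
    0 < mulshift F y (x + \sum_(i < size ys) nth 0 ys i *+ r i).
  by apply: H => z; rewrite mulr_ge0.
rewrite big_ord_recl /=; have := H (r \o S); rewrite /mulshift /=.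
rewrite addrCA [y *+ _ + _]addrC; set z := x + _.
have := F0 z; have := F0 (z + y); rewrite !le0r.
case: (r 0%N); rewrite ?mulr1n ?mulr0n ?addr0.
  by move=> /orP[/eqP ->|//]; rewrite mulr0 ltxx.
by move=> _ /orP[/eqP ->|//]; rewrite mul0r ltxx.
Qed.

Definition diffs s : seq G := [seq y - z | y <- s, z <- s].

Definition average s F (x : G) : R := mean s (fun y => F (x + y)).

Lemma mean_diffs s (F H : G -> R) :
  mean (diffs s) (fun z => \sum_x F x * H (x + z)) =
  \sum_x average s F x * average s H x.
Proof.
rewrite mean_allpairs.
transitivity (mean s (fun y => mean s (fun z => \sum_x F (x + z) * H (x + y)))).
  apply: eq_mean => y; apply: eq_mean => z.
  rewrite -(sum_shift _ z); apply: eq_bigr => x _.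
  by rewrite addrACA subrr addr0.
under eq_mean do rewrite mean_sum.
rewrite mean_sum; apply: eq_bigr => x _.
rewrite mean_exchange mulrC -meanZ; apply: eq_mean => z.
rewrite mulrC -meanZ; apply: eq_mean => y; by rewrite mulrC.
Qed.

(** The source of positivity: averaging a correlation over differences gives a sum of squares. This
    is why squares enter through [diffs]. *)
Lemma mean_diffs_corr s F : mean (diffs s) (corr F) = \sum_x average s F x ^+ 2.
Proof. by rewrite mean_diffs; apply: eq_bigr => x _; rewrite expr2. Qed.

(** Convolution: a point of [s] is distributed as the sum of independent points of [t] and [u], as
    when a square is tiled by translates of a smaller one. *)
Definition refines s t u : Prop :=
  forall c : G -> R, mean s c = mean u (fun z => mean t (fun y => c (y + z))).

(** Jensen for the square: an average over [s] is an average of translated averages over [t]. *)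
Lemma mean_diffs_refines s t u F : (0 < size u)%N -> refines s t u ->
  mean (diffs s) (corr F) <= mean (diffs t) (corr F).
Proof.
move=> u0 stu; rewrite !mean_diffs_corr.
apply: (@le_trans _ _ (mean u (fun z => \sum_x average t F (x + z) ^+ 2))).
  rewrite mean_sum; apply: ler_sum => x _.
  rewrite /average stu; apply: le_trans (mean_sqr_le _ u0) _.
  apply: ler_mean => z _; rewrite le_eqVlt; apply/orP; left; apply/eqP; congr (_ ^+ 2).
  by apply: eq_mean => y; rewrite -addrA [z + y]addrC.
rewrite -[leRHS](mean_const _ u0) le_eqVlt; apply/orP; left; apply/eqP.
by apply: eq_mean => z; rewrite (sum_shift (fun x => average t F x ^+ 2)).
Qed.

(* [diffs t - diffs s] is a positive semidefinite kernel, so it pairs [H] with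
   each translate of [H] at most as strongly as with [H] itself. *)
Lemma mean_diffs_shift s t u H y : (0 < size u)%N -> refines s t u ->
  mean (diffs s) (fun h => corr H (y + h))
    - (mean (diffs t) (corr H) - mean (diffs s) (corr H))
  <= mean (diffs t) (fun h => corr H (y + h)).
Proof.
move=> u0 stu.
pose Hy x := H (x + y).
have E v : mean (diffs v) (fun h => corr H (y + h)) = \sum_x average v H x * average v Hy x.
  rewrite -mean_diffs; apply: eq_mean => h; apply: eq_bigr => x _.
  by rewrite /Hy -addrA [h + y]addrC.
have sq v : \sum_x average v Hy x ^+ 2 = \sum_x average v H x ^+ 2.
  rewrite -(sum_shift (fun x => average v H x ^+ 2) y).
  apply: eq_bigr => x _; congr (_ ^+ 2); apply: eq_mean => z.
  by rewrite /Hy -!addrA [z + y]addrC.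
(* Polarization: monotonicity under refinement is applied to the sum of [H] and its translate. *)
pose S x := H x + Hy x.
have avD v x : average v S x = average v H x + average v Hy x by rewrite -meanD.
have SE v : mean (diffs v) (corr S) =
    2 * mean (diffs v) (corr H) + 2 * mean (diffs v) (fun h => corr H (y + h)).
  rewrite E !mean_diffs_corr.
  transitivity (\sum_x average v H x ^+ 2 + \sum_x average v Hy x ^+ 2
     + 2 * \sum_x average v H x * average v Hy x); last by rewrite sq; ring.
  rewrite mulr_sumr -!big_split; apply: eq_bigr => x _ /=; rewrite avD; ring.
have := mean_diffs_refines S u0 stu; rewrite !SE; lra.
Qed.

(** In the application [v] is a thick arc, [t] the small square and [s] the large one. The arc
    absorbs differences of [t], these are traded for differences of [s] around each point of the
    arc, and the latter absorb the arc. *)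
Lemma mean_corr_ge s t u v (H : G -> R) (e1 e2 : R) :
  (0 < size u)%N -> (0 < size v)%N -> (0 < size s)%N -> refines s t u ->
  (forall c M, (forall z, `|c z| <= M) ->
     `|mean v c - mean v (fun y => mean (diffs t) (fun h => c (y + h)))| <= e1 * M) ->
  (forall c M, (forall z, `|c z| <= M) ->
     `|mean v (fun y => mean (diffs s) (fun h => c (y + h))) - mean (diffs s) c| <= e2 * M) ->
  mean (diffs s) (corr H) - (mean (diffs t) (corr H) - mean (diffs s) (corr H))
    - (e1 + e2) * corr H 0 <= mean v (corr H).
Proof.
move=> u0 v0 s0 stu /(_ (corr H) (corr H 0) (corr_norm_le H)).
rewrite ler_norml => /andP[h1 _].
move=> /(_ (corr H) (corr H 0) (corr_norm_le H)).
rewrite ler_norml => /andP[h2 _].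
have : mean v (fun y => mean (diffs s) (fun h => corr H (y + h))
    - (mean (diffs t) (corr H) - mean (diffs s) (corr H)))
  <= mean v (fun y => mean (diffs t) (fun h => corr H (y + h))).
  by apply: ler_mean => y _; exact: (mean_diffs_shift _ _ u0 stu).
rewrite meanB mean_const // => h3; lra.
Qed.

Lemma box_form_diffs_ge0 n s F : (forall x, 0 <= F x) ->
  0 <= box_form (nseq n s) F.
Proof.
elim: n F => [|n IH] F F0 /=; first exact: total_ge0.
by apply: mean_ge0 => y _; apply: IH => x; rewrite mulr_ge0.
Qed.

Lemma sum_sqr_ge (F : G -> R) : (\sum_x F x) ^+ 2 <= #|G|%:R * \sum_x F x ^+ 2.
Proof.
have E (c : G -> R) : mean (enum G) c = (\sum_x c x) / #|G|%:R.
  by rewrite /mean big_enum -cardT.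
have c0 : (0 < size (enum G))%N by rewrite -cardT; apply/card_gt0P; exists 0.
have := @mean_sqr_le R G (enum G) F c0; rewrite !E.
rewrite -cardT in c0.
have {}c0 : 0 < #|G|%:R :> R by rewrite ltr0n.
by rewrite expr_div_n ler_pdivrMr ?exprn_gt0 // [_%:R ^+ 2]expr2 mulrA divfK ?gt_eqF // mulrC.
Qed.

Lemma total_average s F : (0 < size s)%N -> \sum_x average s F x = total F.
Proof.
move=> s0; rewrite -mean_sum -[RHS](mean_const _ s0); apply: eq_mean => y.
exact: sum_shift.
Qed.

Lemma box_mean_sqr_le ss (Phi : (G -> R) -> R) F :
  all (fun s => 0 < size s)%N ss ->
  box_mean ss Phi F ^+ 2 <= box_mean ss (fun F => Phi F ^+ 2) F.
Proof.
elim: ss F => [|s ss IH] F //= /andP[s0 ss0].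
apply: le_trans (mean_sqr_le _ s0) _.
by apply: ler_mean => y _; apply: IH.
Qed.

Lemma box_meanZ ss (Phi : (G -> R) -> R) a F :
  box_mean ss (fun F => a * Phi F) F = a * box_mean ss Phi F.
Proof.
elim: ss F => [|s ss IH] F //=.
by rewrite -meanZ; apply: eq_mean => y; rewrite IH.
Qed.

(** Each further edge squares the density: [mean (diffs s) (corr H)] is a sum of squared averages,
    at least [total H ^+ 2 / #|G|%:R], and Jensen takes the square out of [box_mean]. *)
Lemma box_form_diffs_ge n s m F : (0 < size s)%N -> admissible m F ->
  (total F / #|G|%:R) ^+ (2 ^ n) <= box_form (nseq n (diffs s)) F / #|G|%:R.
Proof.
move=> s0 Fm; have c0 : 0 < #|G|%:R :> R by rewrite ltr0n; apply/card_gt0P; exists 0.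
have F0 x : 0 <= F x by have /andP[] := Fm.1 x.
have d0 : (0 < size (diffs s))%N by rewrite size_allpairs muln_gt0 s0.
elim: n => [|n IH]; first by rewrite expr1.
rewrite expnS mulnC exprM.
apply: (@le_trans _ _ ((box_form (nseq n (diffs s)) F / #|G|%:R) ^+ 2)).
  rewrite ler_pXn2r ?nnegrE ?exprn_ge0 ?divr_ge0 ?ler0n ?total_ge0 //.
  exact: box_form_diffs_ge0.
rewrite expr_div_n expr2 [_ ^+ 2 in leLHS]expr2 invfM mulrA ler_pM2r ?invr_gt0 //.
rewrite [nseq _.+1 _]/= box_form_cons mulrC -expr2.
apply: (@le_trans _ _ (box_mean (nseq n (diffs s)) (fun H => #|G|%:R^-1 * total H ^+ 2) F)).
  by rewrite box_meanZ ler_pM2l ?invr_gt0 // box_mean_sqr_le // all_nseq d0 orbT.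
apply: (@ler_box_mean _ _ _ m) => // H _.
rewrite mean_diffs_corr -(total_average H s0) mulrC ler_pdivrMr // mulrC.
exact: sum_sqr_ge.
Qed.

Lemma box_form_le_total ss m F : admissible m F -> all (fun s => 0 < size s)%N ss ->
  box_form ss F <= m.
Proof.
move=> Fm ss0; rewrite -[leRHS](@box_mean_const ss F m) //.
by apply: (@ler_box_mean _ _ _ m) => // H [].
Qed.

(** The increments telescope from a nonnegative value to one at most [m], so one of them is at most
    [m / J%:R]. *)
Lemma exists_stable_scale (chi u : nat -> seq G) (J n : nat) m F :
  (0 < J)%N -> admissible m F -> (forall j, 0 < size (chi j))%N ->
  (forall j, 0 < size (u j))%N ->
  (forall j, (j < J)%N -> refines (chi j) (chi j.+1) (u j)) ->
  exists2 j, (j < J)%N &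
    box_form (nseq n (diffs (chi j.+1))) F - box_form (nseq n (diffs (chi j))) F
      <= m / J%:R.
Proof.
move=> J0 Fm c0 u0 ref; pose N j := box_form (nseq n (diffs (chi j))) F.
have F0 x : 0 <= F x by have /andP[] := Fm.1 x.
have dn j : all (fun s => 0 < size s)%N (nseq n (diffs (chi j))).
  by rewrite all_nseq size_allpairs muln_gt0 c0 orbT.
apply: contrapT => /forall2NP nj.
have : \sum_(0 <= j < J) (m / J%:R) < \sum_(0 <= j < J) (N j.+1 - N j).
  apply: ltr_sum_nat => // j /= jJ; have [//|] := nj j.
  by move/negP; rewrite -ltNge.
rewrite telescope_sumr // sumr_const_nat subn0 -[_ *+ J]mulr_natr divfK ?pnatr_eq0 -?lt0n //.
apply/negP; rewrite -leNgt -[leRHS]subr0; apply: lerB.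
  exact: box_form_le_total Fm (dn J).
exact: box_form_diffs_ge0.
Qed.

End box.

(** * Sums along nearly arithmetic progressions *)

Section counting.
Context {R : archiRealFieldType}.
Implicit Types (c : int -> R) (M : R).

Lemma window_shift m c M (e : int) : (forall z, `|c z| <= M) ->
  `|\sum_(i < m) c (i%:Z + e) - \sum_(i < m) c i%:Z| <= 2 * `|e|%:~R * M.
Proof.
have pos (d : int -> R) (n : nat) : (forall z, `|d z| <= M) ->
    `|\sum_(i < m) d (i%:Z + n%:Z) - \sum_(i < m) d i%:Z| <= 2 * n%:R * M.
  move=> dM; elim: n => [|n IH].
    by under eq_bigr do rewrite addr0; rewrite subrr normr0 mulr0 mul0r.
  rewrite -(subrK (\sum_(i < m) d (i%:Z + n%:Z)) (\sum_(i < m) d (i%:Z + n.+1%:Z))).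
  rewrite -addrA; apply: le_trans (ler_normD _ _) _.
  have -> : 2 * n.+1%:R * M = 2 * M + 2 * n%:R * M by rewrite -natr1; ring.
  apply: lerD => //.
  pose g i := d (i%:Z + n%:Z).
  have -> : \sum_(i < m) d (i%:Z + n.+1%:Z) = \sum_(0 <= i < m) g i.+1.
    by rewrite big_mkord; apply: eq_bigr => i _; congr d; lia.
  rewrite -(big_mkord xpredT g) -sumrB telescope_sumr //.
  by rewrite mulr_natl mulr2n; apply: le_trans (ler_normB _ _) _; rewrite lerD // dM.
move=> cM; case: e => n; first exact: pos.
have := pos (fun z => c (z + Negz n)) n.+1 (fun z => cM _).
have -> : \sum_(i < m) c (i%:Z + n.+1%:Z + Negz n) = \sum_(i < m) c i%:Z.
  by apply: eq_bigr => i _; congr c; lia.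
rewrite distrC.
have -> : `|Negz n|%:~R = n.+1%:R :> R by rewrite NegzE normrN ger0_norm // pmulrn.
by [].
Qed.

(* A multiplicity function bounded by [D] on an interval of length [V], of total
   mass [#|I|], is within [D * V - #|I|] of the constant [D] in [l1]. *)
Lemma sum_near_uniform (I : finType) (v : I -> int) (v0 : int) (V : nat) (D M : R) c :
  (forall i, v0 <= v i < v0 + V%:Z) ->
  (forall z, #|[pred i | v i == z]|%:R <= D) ->
  (forall z, `|c z| <= M) ->
  `|\sum_i c (v i) - D * \sum_(z < V) c (z%:Z + v0)| <= (D * V%:R - #|I|%:R) * M.
Proof.
move=> vV vD cM.
pose d (z : 'I_V) : R := #|[pred i | v i == z%:Z + v0]|%:R.
have hit (i : I) : exists z : 'I_V, v i == z%:Z + v0.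
  have /andP[a b] := vV i; have zV : (absz (v i - v0) < V)%N by lia.
  by exists (Ordinal zV) => /=; apply/eqP; lia.
have split_sum (e : int -> R) : \sum_i e (v i) = \sum_(z < V) d z * e (z%:Z + v0).
  pose p i := xchoose (hit i).
  have pP i : v i = (p i)%:Z + v0 by apply/eqP/(xchooseP (hit i)).
  rewrite (partition_big p xpredT) //=; apply: eq_bigr => z _.
  have pz i : (p i == z) = (v i == z%:Z + v0).
    by rewrite pP; apply/eqP/eqP => [->//|h]; apply: val_inj => /=; lia.
  rewrite (eq_bigr (fun=> e (z%:Z + v0))) => [|i /eqP <-]; last by rewrite pP.
  rewrite sumr_const /d mulr_natl; congr (_ *+ _).
  by apply: eq_card => i; rewrite [RHS]inE /= -pz.
have card : #|I|%:R = \sum_(z < V) d z.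
  rewrite -sum1_card natr_sum (split_sum (fun=> 1)).
  by apply: eq_bigr => z _; rewrite mulr1.
rewrite split_sum mulr_sumr -sumrB card.
have -> : D * V%:R - \sum_(z < V) d z = \sum_(z < V) (D - d z).
  by rewrite sumrB sumr_const card_ord mulr_natr.
rewrite mulr_suml; apply: le_trans (ler_norm_sum _ _ _) _.
apply: ler_sum => z _; rewrite -mulrBl normrM distrC.
have dD : 0 <= D - d z by rewrite subr_ge0 vD.
by rewrite (ger0_norm dD) ler_wpM2l.
Qed.

(** Both sums are compared with [D] times a sum over a full interval, where a shift affects only the
    two ends. *)
Lemma sum_shift_near_uniform (I : finType) (v : I -> int) (v0 : int) (V : nat)
    (D M : R) c (h : int) :
  (forall i, v0 <= v i < v0 + V%:Z) ->
  (forall z, #|[pred i | v i == z]|%:R <= D) ->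
  (forall z, `|c z| <= M) ->
  `|\sum_i (c (v i) - c (v i + h))|
    <= 2 * (D * V%:R - #|I|%:R + `|h|%:~R * D) * M.
Proof.
move=> vV vD cM.
have D0 : 0 <= D by apply: le_trans (vD 0); rewrite ler0n.
have h1 := sum_near_uniform vV vD cM.
have h2 := sum_near_uniform vV vD (fun z => cM (z + h)).
have h3 := window_shift V h (fun z => cM (z + v0)).
rewrite sumrB.
set A := \sum_i _ in h1 *; set B := \sum_i _ in h2 *.
set A' := \sum_(_ < V) _ in h1; set B' := \sum_(_ < V) _ in h2.
have hAB : `|B' - A'| <= 2 * `|h|%:~R * M.
  apply: le_trans h3; rewrite le_eqVlt; apply/orP; left; apply/eqP; congr (`|_ - _|).
  by apply: eq_bigr => z _; rewrite addrAC.
have h4 : `|D * B' - D * A'| <= D * (2 * `|h|%:~R * M).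
  by rewrite -mulrBr normrM ger0_norm // ler_wpM2l.
have -> : A - B = (A - D * A') - (B - D * B') - (D * B' - D * A') by ring.
apply: le_trans (ler_normB _ _) _.
apply: le_trans (lerD (ler_normB _ _) (lexx _)) _.
apply: le_trans (lerD (lerD h1 h2) h4) _.
by rewrite le_eqVlt; apply/orP; left; apply/eqP; ring.
Qed.

Lemma card_spread_le (m : nat) (A : {set 'I_m}) (D : R) : 0 <= D ->
  (forall i i' : 'I_m, i \in A -> i' \in A -> (i < i')%N -> (i' - i)%:R <= D) ->
  #|A|%:R <= D + 1.
Proof.
move=> D0 AD; have [->|[i0 i0A]] := set_0Vmem A; first by rewrite cards0; lra.
case: (arg_minnP (fun i : 'I_m => i : nat) i0A) => a aA amin.
case: (arg_maxnP (fun i : 'I_m => i : nat) i0A) => b bA bmax.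
have ab : (b - a)%:R <= D.
  have := amin b bA; rewrite leq_eqVlt => /orP[/eqP ->|]; first by rewrite subnn.
  exact: AD.
apply: le_trans (_ : (b - a).+1%:R <= _); last by rewrite -natr1 lerD2r.
rewrite ler_nat -[leqRHS]card_ord.
rewrite -(card_in_imset (f := fun i : 'I_m => inord (i - a) : 'I_(b - a).+1)).
  exact: max_card.
move=> i i' iA i'A /(congr1 val) /=.
have := amin i iA; have := amin i' i'A; have := bmax i iA; have := bmax i' i'A.
move=> h1 h2 h3 h4; rewrite !inordK; [move=> e; apply: val_inj => /=; lia|lia|lia].
Qed.

(** For each [i] at most one second component gives the value [z], so it suffices to count the [i]
    with [psi i] in a window of [W] integers. The slack 2 leaves 1 for the rounding in each of
    [psi i] and [psi i']. *)
Lemma card_window_le (m W : nat) (psi : 'I_m -> int) (al : R) (z : int) : 0 < al ->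
  (forall i i' : 'I_m, (i < i')%N ->
    al * (i' - i)%:R - 2 <= (psi i' - psi i)%:~R) ->
  #|[pred p : 'I_m * 'I_W | psi p.1 + p.2%:Z == z]|%:R <= (W%:R + 1) / al + 1.
Proof.
move=> al0 inc.
pose A := [set i : 'I_m | z - W%:Z < psi i <= z].
apply: le_trans (_ : #|A|%:R <= _).
  rewrite ler_nat -(card_in_imset (f := fst)); last first.
    move=> [i w] [i' w']; rewrite !inE /= => /eqP h1 /eqP h2 e.
    by rewrite e in h1 *; congr pair; apply: val_inj => /=; lia.
  apply/subset_leq_card/fintype.subsetP => i /imsetP[[i' w]]; rewrite !inE /= => /eqP h ->.
  have := ltn_ord w; lia.
apply: card_spread_le; first by rewrite divr_ge0 ?addr_ge0 ?ler0n // ltW.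
move=> i i'; rewrite !inE => iA i'A ii'.
rewrite ler_pdivlMr // mulrC.
have h := inc i i' ii'.
have h2 : (psi i' - psi i)%:~R <= W%:R - 1 :> R.
  have -> : W%:R - 1 = (W%:Z - 1)%:~R :> R by rewrite rmorphB.
  rewrite ler_int; lia.
lra.
Qed.

End counting.

(** * Curvature of the circle *)

Section circle.
Context {R : realType}.
Implicit Types (L s t u : R).

Definition circle_height L t : R := Num.sqrt (L ^+ 2 - t ^+ 2).

Lemma circle_height_sqr L t : 0 <= t -> t <= L ->
  circle_height L t ^+ 2 = L ^+ 2 - t ^+ 2.
Proof. by move=> t0 tL; rewrite sqr_sqrtr // subr_ge0; nra. Qed.

Lemma circle_height_le L t : 0 <= L -> circle_height L t <= L.
Proof.
move=> L0; rewrite /circle_height -[leRHS](ger0_norm L0) -sqrtr_sqr ler_wsqrtr //.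
have := sqr_ge0 t; lra.
Qed.

Lemma circle_height_ge L t q : 0 <= L -> 0 <= q <= 1 -> 0 <= t <= q * L ->
  (1 - q ^+ 2) * L <= circle_height L t.
Proof.
move=> L0 /andP[q0 q1] /andP[t0 tq].
have p0 : 0 <= (1 - q ^+ 2) * L by rewrite mulr_ge0 // subr_ge0; nra.
rewrite -(ger0_norm p0) -sqrtr_sqr ler_wsqrtr // exprMn.
have h1 : t ^+ 2 <= q ^+ 2 * L ^+ 2 by rewrite -exprMn; nra.
have h2 : 0 <= q ^+ 2 * (1 - q ^+ 2) * L ^+ 2.
  by rewrite !mulr_ge0 ?sqr_ge0 // subr_ge0; nra.
have -> : ((1 - q ^+ 2) ^+ 2 * L ^+ 2) = L ^+ 2 - q ^+ 2 * L ^+ 2 - q ^+ 2 * (1 - q ^+ 2) * L ^+ 2 by ring.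
lra.
Qed.

Lemma circle_height_mono L s t : 0 <= s -> s <= t -> circle_height L t <= circle_height L s.
Proof. by move=> s0 st; rewrite ler_wsqrtr // lerD2l lerN2; nra. Qed.

Lemma circle_height_lip L s t : 0 < L -> 0 <= s <= L / 2 -> 0 <= t <= L / 2 ->
  `|circle_height L s - circle_height L t| <= `|s - t|.
Proof.
move=> L0.
wlog st : s t / s <= t.
  move=> H s0 t0; have [st|ts] := leP s t; first exact: H.
  by rewrite distrC [leRHS]distrC; apply: H => //; exact: ltW.
move=> /andP[s0 sL] /andP[t0 tL].
have sq1 : circle_height L s ^+ 2 = L ^+ 2 - s ^+ 2 by apply: circle_height_sqr; lra.
have sq2 : circle_height L t ^+ 2 = L ^+ 2 - t ^+ 2 by apply: circle_height_sqr; lra.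
have m := circle_height_mono L s0 st.
have h x : 0 <= x <= L / 2 -> (1 - (2^-1) ^+ 2) * L <= circle_height L x.
  by move=> /andP[x0 xL]; apply: circle_height_ge; lra.
have g1 := h s; have g2 := h t.
rewrite s0 sL in g1; rewrite t0 tL in g2; have {}g1 := g1 isT; have {}g2 := g2 isT.
rewrite ger0_norm ?subr_ge0 // distrC ger0_norm ?subr_ge0 //.
set a := circle_height L s in sq1 m g1 *; set c := circle_height L t in sq2 m g2 *.
have e : (a - c) * (a + c) = (t - s) * (t + s) by rewrite -!subr_sqr sq1 sq2; ring.
have p : 0 < a + c by lra.
rewrite -(ler_pM2r p) e ler_wpM2l ?subr_ge0 //; lra.
Qed.

(** Here [a], [b], [c], [d] are the heights at [s], [s + u], [t], [t + u]. No derivative is taken: a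
    difference of heights times the corresponding sum is a polynomial in [s], [t], [u], and the sums
    are close to [2 * L]. *)
Let second_difference_bounds (a b c d L q s t u : R) :
  0 < L -> 0 <= q <= 1 / 4 -> 0 <= s -> s <= t -> 0 <= u -> t + u <= q * L ->
  a ^+ 2 = L ^+ 2 - s ^+ 2 -> b ^+ 2 = L ^+ 2 - (s + u) ^+ 2 ->
  c ^+ 2 = L ^+ 2 - t ^+ 2 -> d ^+ 2 = L ^+ 2 - (t + u) ^+ 2 ->
  (1 - q ^+ 2) * L <= d -> d <= c -> d <= b -> c <= a -> b <= a -> a <= L ->
  u * (t - s) <= ((c - d) - (a - b)) * L <= (1 + 4 * q) * (u * (t - s)).
Proof.
move=> L0 /andP[q0 q1] s0 st u0 tu a2 b2 c2 d2 gd dc db ca ba aL.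
set X := (c - d) - (a - b); set g := (1 - q ^+ 2) * L in gd.
have p0 : 15 / 16 <= 1 - q ^+ 2 by nra.
have g0 : 0 < g by apply: mulr_gt0 => //; lra.
have e1 : (a - b) * (a + b) = u * (2 * s + u) by rewrite -subr_sqr a2 b2; ring.
have e2 : (c - d) * (c + d) = u * (2 * t + u) by rewrite -subr_sqr c2 d2; ring.
have e3 : (a - c) * (a + c) = (t - s) * (t + s) by rewrite -subr_sqr a2 c2; ring.
have e4 : (b - d) * (b + d) = (t - s) * (s + t + 2 * u) by rewrite -subr_sqr b2 d2; ring.
have ts : 0 <= t - s by lra.
have uts : 0 <= u * (t - s) by rewrite mulr_ge0.
have lo1 : 2 * (u * (t - s)) <= X * (a + b).
  have : (c - d) * (c + d) <= (c - d) * (a + b) by rewrite ler_wpM2l; lra.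
  have -> : X * (a + b) = (c - d) * (a + b) - (a - b) * (a + b) by rewrite /X; ring.
  rewrite e1 e2; lra.
have X0 : 0 <= X by rewrite -(pmulr_lge0 X (x := a + b)); lra.
have lo : u * (t - s) <= X * L.
  have : X * (a + b) <= X * (2 * L) by rewrite ler_wpM2l //; lra.
  lra.
apply/andP; split=> //.
pose p := 1 - q ^+ 2; have gE : g = p * L by [].
have half y z w v : 0 <= y -> 2 * g <= z -> y * z = w * v -> 0 <= w -> v <= 2 * (q * L) ->
    y * p <= w * q.
  move=> y0 gz e w0 vq.
  have h1 : y * (2 * g) <= y * z by rewrite ler_wpM2l.
  have h2 : w * v <= w * (2 * (q * L)) by rewrite ler_wpM2l.
  rewrite -(ler_pM2r L0); rewrite gE in h1; lra.
have h1 : (a - b) * p <= u * q by apply: half e1 _ _; lra.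
have h2 : (a - c) * p <= (t - s) * q by apply: half e3 _ _; lra.
have h3 : (b - d) * p <= (t - s) * q by apply: half e4 _ _; lra.
(* The error term is a product of first differences, each carrying a factor [q], hence of second
   order in [q]. *)
have eX : X * (c + d) = 2 * (u * (t - s)) + (a - b) * ((a - c) + (b - d)).
  have -> : X * (c + d) = (c - d) * (c + d) - (a - b) * (a + b)
     + (a - b) * ((a - c) + (b - d)) by rewrite /X; ring.
  by rewrite e1 e2; ring.
have h4 : (a - b) * p * (((a - c) + (b - d)) * p) <= u * q * (2 * ((t - s) * q)).
  have pp : 0 <= p by rewrite /p; lra.
  by apply: ler_pM => //; [rewrite mulr_ge0 //; lra|rewrite mulr_ge0 //; lra|rewrite mulrDl; lra].
have h5 : X * (2 * g) <= X * (c + d) by rewrite ler_wpM2l //; lra.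
have p3 : 0 < p ^+ 3 by rewrite exprn_gt0 // /p; lra.
have h6 : X * p ^+ 3 * L <= (p ^+ 2 + q ^+ 2) * (u * (t - s)).
  have h7 : X * (2 * g) * p ^+ 2 <= X * (c + d) * p ^+ 2 by rewrite ler_wpM2r ?sqr_ge0.
  rewrite eX gE in h7.
  have e5 : (2 * (u * (t - s)) + (a - b) * ((a - c) + (b - d))) * p ^+ 2 =
     2 * (u * (t - s)) * p ^+ 2 + (a - b) * p * (((a - c) + (b - d)) * p) by ring.
  have e6 : X * (2 * (p * L)) * p ^+ 2 = 2 * (X * p ^+ 3 * L) by ring.
  rewrite e5 e6 in h7; lra.
have h8 : p ^+ 2 + q ^+ 2 <= (1 + 4 * q) * p ^+ 3.
  have -> : (1 + 4 * q) * p ^+ 3 = p ^+ 2 + q * p ^+ 2 * (4 * p - q) by rewrite /p; ring.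
  have p2 : 4 / 5 <= p ^+ 2 by rewrite /p; nra.
  have h9 : 3 <= 4 * p - q by rewrite /p; lra.
  have h10 : 0 <= (p ^+ 2 - 4 / 5) * (4 * p - q - 3) by rewrite mulr_ge0; lra.
  have h11 : q <= p ^+ 2 * (4 * p - q) by nra.
  have := ler_wpM2l q0 h11; rewrite mulrA expr2; lra.
rewrite -(ler_pM2r p3).
have := ler_wpM2r uts h8; lra.
Qed.

(** The second derivative of the height is at least [1 / L] in absolute value, and close to it near
    the top of the circle. Hence, for fixed [u], the drop in height over a distance [u] grows in
    nearly constant steps [u / L]. *)
Lemma circle_second_difference L q s t u : 0 < L -> 0 <= q <= 1 / 4 ->
  0 <= s -> s <= t -> 0 <= u -> t + u <= q * L ->
  u * (t - s) / L <=
    (circle_height L t - circle_height L (t + u))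
      - (circle_height L s - circle_height L (s + u))
  <= (1 + 4 * q) * (u * (t - s) / L).
Proof.
move=> L0 q01 s0 st u0 tu; have /andP[q0 q1] := q01.
have qL : q * L <= L by rewrite ler_piMl; lra.
have sq x : 0 <= x -> x <= q * L -> circle_height L x ^+ 2 = L ^+ 2 - x ^+ 2.
  by move=> x0 xL; apply: circle_height_sqr; lra.
rewrite ler_pdivrMr // mulrA ler_pdivlMr //.
apply: (second_difference_bounds L0 q01 s0 st u0 tu); try by apply: sq; lra.
- by apply: circle_height_ge; lra.
- by apply: circle_height_mono; lra.
- by apply: circle_height_mono; lra.
- exact: circle_height_mono.
- by apply: circle_height_mono; lra.
- by apply: circle_height_le; lra.
Qed.

End circle.

(** * Equidistribution of the vertical differences on a discretized arc *)

Section lattice_circle.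
Context {R : realType}.
Implicit Types (L M : R) (c : int -> R).

Definition lattice_height L (t : int) : int := Num.floor (circle_height L t%:~R).

Lemma lattice_height_itv L t :
  circle_height L t%:~R - 1 < (lattice_height L t)%:~R <= circle_height L t%:~R.
Proof.
have /andP[h1 h2] := floor_itv (circle_height L t%:~R).
by rewrite h1 andbT ltrBlDr; rewrite intrD in h2.
Qed.

(** [D] is the maximal multiplicity and [V] the length of the range. The main term of [D * V] is the
    number [m * kk] of pairs, and cancels; what remains is of the order of the number [kk ^+ 5 * bb]
    of abscissae, a gain of a factor [kk] over the trivial bound. *)
Let scale_arith (kk bb m x u L D V : R) :
  4 <= kk -> 1 <= bb -> 0 <= m <= kk ^+ 5 * bb ->
  kk ^+ 7 * bb <= L <= 2 * (kk ^+ 7 * bb) ->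
  kk ^+ 4 * bb <= u <= kk ^+ 5 * bb -> 0 <= x <= kk * bb ->
  D = (kk + 1) / (u / L) + 1 ->
  0 <= V <= (1 + 4 * kk^-1) * (u / L * m) + kk + 2 ->
  2 * (D * V - m * kk + x * D) <= 30 * (kk ^+ 5 * bb).
Proof.
move=> k4 b1 /andP[m0 mK] /andP[L1 L2] /andP[u1 u2] /andP[x0 x1] DE /andP[V0 V1].
have kb0 n : 0 < kk ^+ n * bb by rewrite mulr_gt0 ?exprn_gt0 //; lra.
have u0 : 0 < u by apply: lt_le_trans u1.
have L0 : 0 < L by apply: lt_le_trans L1.
pose al := u / L; pose y := L / u.
have aly : al * y = 1 by rewrite /al /y mulrA divfK ?gt_eqF // mulfV // gt_eqF.
have al0 : 0 < al by rewrite divr_gt0.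
have y0 : 0 < y by rewrite divr_gt0.
have k0 : 0 < kk by lra.
have y1 : y <= 2 * kk ^+ 3.
  rewrite ler_pdivrMr //; apply: le_trans L2 _.
  have -> : 2 * (kk ^+ 7 * bb) = 2 * kk ^+ 3 * (kk ^+ 4 * bb) by ring.
  by rewrite ler_pM2l // mulr_gt0 // exprn_gt0.
have al1 : al * kk ^+ 2 <= 1.
  rewrite mulrAC ler_pdivrMr // mul1r.
  apply: le_trans L1; have -> : kk ^+ 7 * bb = kk ^+ 5 * bb * kk ^+ 2 by ring.
  by rewrite ler_pM2r // exprn_gt0.
have {}DE : D = (kk + 1) * y + 1 by rewrite DE /y invf_div.
pose q := kk^-1; have qk : q * kk = 1 by rewrite mulVf // gt_eqF.
have q0 : 0 < q by rewrite invr_gt0.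
have q1 : q <= 1 / 4 by rewrite -(ler_pM2r k0) qk; lra.
set K := kk ^+ 5 * bb in mK u2 *.
have b0 : 0 < bb by lra.
have k5K : kk ^+ 5 <= K by rewrite ler_peMr // exprn_ge0 // ltW.
have pow n : kk ^+ n * 4 <= kk ^+ n.+1 by rewrite exprSr ler_pM2l // exprn_gt0.
have p1 := pow 1%N; have p2 := pow 2%N; have p3 := pow 3%N; have p4 := pow 4%N.
rewrite expr1 in p1.
have D0 : 0 <= D by rewrite DE addr_ge0 // mulr_ge0 //; lra.
have hDV : D * V <= D * ((1 + 4 * q) * (al * m) + kk + 2) by rewrite ler_wpM2l.
have am1 : al * m <= m.
  rewrite ler_piMl //; have : al * 16 <= al * kk ^+ 2 by rewrite ler_pM2l //; lra.
  lra.
have am0 : 0 <= al * m by rewrite mulr_ge0 // ltW.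
have eDV : D * ((1 + 4 * q) * (al * m) + kk + 2) =
   (kk * m + m + 4 * (q * kk) * m + 4 * q * m) * (al * y)
   + y * ((kk + 1) * (kk + 2)) + (1 + 4 * q) * (al * m) + kk + 2 by rewrite DE; ring.
rewrite eDV qk aly !mulr1 in hDV.
have t1 : 4 * q * m <= m by rewrite ler_piMl //; lra.
have t2 : (1 + 4 * q) * (al * m) <= 2 * (al * m) by rewrite ler_wpM2r //; lra.
have t3 : y * ((kk + 1) * (kk + 2)) <= 4 * kk ^+ 5.
  have -> : 4 * kk ^+ 5 = (2 * kk ^+ 3) * (2 * kk ^+ 2) by ring.
  apply: ler_pM => //; [exact: ltW|rewrite mulr_ge0; lra|].
  rewrite expr2 in p1 *; lra.
have t4 : x * D <= kk * bb * ((kk + 1) * (2 * kk ^+ 3) + 1).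
  apply: ler_pM => //; rewrite DE lerD2r ler_pM2l //; lra.
have e4 : kk * bb * ((kk + 1) * (2 * kk ^+ 3) + 1) =
   2 * K + 2 * (kk ^+ 4 * bb) + kk * bb by rewrite /K; ring.
rewrite e4 in t4.
have t5 : 4 * (kk ^+ 4 * bb) <= K by rewrite /K mulrA ler_pM2r //; lra.
have t6 : 4 * (kk * bb) <= K by rewrite /K mulrA ler_pM2r //; lra.
lra.
Qed.

Let aux (a c d e f : nat) : (e < c - d)%N -> (a + c <= f)%N -> (a + e + d <= f)%N.
Proof. lia. Qed.

(* The [psi i] progress with almost constant step [u / L].  All the lengths of a
   scale are multiples of the side [b] of its small square: the radius is about
   [k ^ 7 * b], the large square has side [k ^ 8 * b], the abscissae are below
   [k ^ 6 * b], an arc spans [k ^ 5 * b] of them, pairs of abscissae closer than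
   [k ^ 4 * b] are negligible, and thin and thick arcs have heights [k] and
   [k * b]. *)
Lemma curvature_sum (k b u T : nat) L (h : int) c M (psi : nat -> int) :
  psi =1 (fun i => lattice_height L (T + i)%:Z - lattice_height L (T + i + u)%:Z) ->
  (4 <= k)%N -> (0 < b)%N -> (T + k ^ 5 * b <= k ^ 6 * b)%N ->
  (k ^ 7 * b)%:R <= L <= 2 * (k ^ 7 * b)%:R ->
  (k ^ 4 * b <= u <= k ^ 5 * b)%N -> `|h| <= (k * b)%:Z ->
  (forall z, `|c z| <= M) ->
  `|\sum_(p : 'I_(k ^ 5 * b - u) * 'I_k)
     (c (psi p.1 + p.2%:Z) - c (psi p.1 + p.2%:Z + h))|
    <= 30 * (k ^ 5 * b)%:R * M.
Proof.
move=> psiE k4 b0 TK Lk /andP[u1 u2] hk cM.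
have kE n : (k ^ n * b)%:R = k%:R ^+ n * b%:R :> R by rewrite natrM natrX.
rewrite !kE in Lk *; have /andP[L1 L2] := Lk.
have M0 : 0 <= M by apply: le_trans (cM 0); rewrite normr_ge0.
have kk4 : 4 <= k%:R :> R by rewrite ler_nat.
have bb1 : 1 <= b%:R :> R by rewrite ler1n.
have L0 : 0 < L.
  by apply: lt_le_trans L1; rewrite mulr_gt0 ?exprn_gt0 //; lra.
have u0 : 0 < u%:R :> R.
  by rewrite ltr0n; apply: leq_trans u1; rewrite muln_gt0 expn_gt0 b0 andbT; lia.
set m := (k ^ 5 * b - u)%N.
pose H x := circle_height L x.
pose Psi (i : nat) := H (T + i)%:R - H (T + i + u)%:R.
have psiP i : Psi i - 1 < (psi i)%:~R < Psi i + 1.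
  rewrite psiE rmorphB /=.
  have := lattice_height_itv L (T + i)%:Z; have := lattice_height_itv L (T + i + u)%:Z.
  rewrite /Psi /H -!pmulrn => /andP[a1 a2] /andP[a3 a4]; apply/andP; split; lra.
have k0 : 0 < k%:R :> R by lra.
have q14 : 0 <= (k%:R^-1 : R) <= 1 / 4.
  by rewrite invr_ge0 ler0n /= -(ler_pM2r k0) mulVf ?gt_eqF //; lra.
have inc (i j : nat) : (i <= j)%N -> (j < m)%N ->
    u%:R / L * (j - i)%:R <= Psi j - Psi i <= (1 + 4 * k%:R^-1) * (u%:R / L * (j - i)%:R).
  move=> ij jm; rewrite mulrAC.
  have := @circle_second_difference R L k%:R^-1 (T + i)%:R (T + j)%:R u%:R L0 q14.
  have -> : (T + j)%:R - (T + i)%:R = (j - i)%:R :> R.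
    by rewrite natrB // !natrD; ring.
  rewrite -!natrD; apply; rewrite ?ler0n ?ler_nat ?leq_add2l //.
  rewrite mulrC ler_pdivlMr //; apply: le_trans (_ : (k ^ 6 * b)%:R * k%:R <= _).
    by rewrite ler_pM2r // ler_nat; exact: aux jm TK.
  apply: le_trans L1; rewrite kE le_eqVlt; apply/orP; left; apply/eqP; ring.
(* [D] bounds the multiplicity of a value of [psi p.1 + p.2%:Z], and [rho] the variation of [Psi]
   over the arc. *)
pose D : R := (k%:R + 1) / (u%:R / L) + 1.
pose rho : R := (1 + 4 * k%:R^-1) * (u%:R / L * m%:R).
have al0 : 0 < u%:R / L by rewrite divr_gt0.
have rho0 : 0 <= rho.
  have /andP[q0 _] := q14.
  by apply: mulr_ge0; [lra|rewrite mulr_ge0 ?ler0n // ltW].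
(* Beyond [rho] there is room for [p.2], for the rounding of [psi], and for that of the origin
   [Num.floor (Psi 0)]. *)
pose V := (Num.truncn (rho + k%:R + 1)).+1.
have Vle : V%:R <= rho + k%:R + 2.
  rewrite /V -natr1.
  have : (Num.truncn (rho + k%:R + 1))%:R <= rho + k%:R + 1.
    by rewrite truncn_le; lra.
  lra.
have Vgt : rho + k%:R + 1 < V%:R by exact: truncnS_gt.
have Psi0 (i : nat) : (i < m)%N -> Psi 0 <= Psi i <= Psi 0 + rho.
  move=> im; have := inc 0%N i (leq0n _) im; rewrite subn0 => /andP[h1 h2].
  have h3 : 0 <= u%:R / L * i%:R by rewrite mulr_ge0 // ltW.
  have h4 : (1 + 4 * k%:R^-1) * (u%:R / L * i%:R) <= rho.
    have /andP[q0 _] := q14.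
    have q1 : 0 <= 1 + 4 * k%:R^-1 :> R by lra.
    by rewrite ler_wpM2l // ler_pM2l // ler_nat ltnW.
  by apply/andP; split; lra.
apply: (@le_trans _ _ (2 * (D * V%:R - #|{: 'I_m * 'I_k}|%:R + `|h|%:~R * D) * M)).
  have := @sum_shift_near_uniform R ('I_m * 'I_k)%type (fun p => psi p.1 + p.2%:Z) (Num.floor (Psi 0)) V D M c h.
  move=> H1; timeout 20 (apply: H1; last exact: cM).
    move=> [i w] /=; have /andP[p1 p2] := psiP i; have /andP[p3 p4] := Psi0 i (ltn_ord i).
    have /andP[f1 f2] := floor_itv (Psi 0).
    have wk : (w : nat)%:R <= k%:R - 1 :> R.
      by rewrite lerBrDr natr1 ler_nat.
    have w0 : 0 <= (w : nat)%:R :> R by rewrite ler0n.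
    rewrite intrD in f2.
    apply/andP; split.
      rewrite -ltzD1 -(ltr_int R) !intrD -pmulrn; lra.
    rewrite -(ltr_int R) !intrD -!pmulrn; lra.
  move=> z; apply: (@card_window_le _ _ _ (fun i : 'I_m => psi i) (u%:R / L)) => // i i' ii'.
  have /andP[h1 _] := inc i i' (ltnW ii') (ltn_ord i').
  have /andP[a1 a2] := psiP i; have /andP[a3 a4] := psiP i'.
  rewrite intrB; lra.
rewrite ler_wpM2r // card_prod !card_ord natrM.
apply: (@scale_arith _ _ _ _ u%:R L) => //.
- by rewrite ler0n -kE ler_nat leq_subr.
- by rewrite -!kE !ler_nat u1.
- by rewrite -natrM ler0z normr_ge0 -(ler_int R) -pmulrn in hk *.
- by rewrite ler0n.
Qed.

End lattice_circle.

(** * Arcs and squares in a finite abelian group *)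

Section iota_means.
Context {R : realFieldType}.

Lemma mean_iota n (c : nat -> R) : mean (iota 0 n) c = (\sum_(i < n) c i) / n%:R.
Proof. by rewrite /mean size_iota -[iota 0 n]/(iota 0 n) -{1}(subn0 n) big_mkord. Qed.

Lemma sum_iota_mul a b (c : nat -> R) :
  \sum_(i < a * b) c i = \sum_(j < b) \sum_(i < a) c (a * j + i)%N.
Proof.
elim: b => [|b IH]; first by rewrite muln0 !big_ord0.
rewrite big_ord_recr /= -IH mulnS addnC -(big_mkord xpredT c).
rewrite (big_cat_nat (n := a * b)) //=; last by rewrite leq_addr.
rewrite big_mkord; congr (_ + _).
rewrite -{1}[(a * b)%N]add0n big_addn addKn big_mkord.
by apply: eq_bigr => i _; rewrite addnC.
Qed.

Lemma mean_iota_mul a b (c : nat -> R) :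
  mean (iota 0 (a * b)) c =
  mean (iota 0 b) (fun j => mean (iota 0 a) (fun i => c (a * j + i)%N)).
Proof.
rewrite !mean_iota sum_iota_mul natrM invfM mulrA.
under [in RHS]eq_bigr do rewrite mean_iota.
by rewrite -mulr_suml.
Qed.

(** Grouping pairs of columns by their distance [u] fixes the horizontal difference, which is the
    setting of [curvature_sum]. *)
Lemma sum_pairs_by_distance n (X : nat -> nat -> R) :
  \sum_(i < n) \sum_(j < n) X i j =
  \sum_(i < n) X i i
    + \sum_(1 <= u < n) \sum_(i < n - u) (X i (i + u)%N + X (i + u)%N i).
Proof.
elim: n => [|n IH]; first by rewrite !big_ord0 big_geq // addr0.
rewrite big_ord_recr /=.
under eq_bigr do rewrite big_ord_recr /=.
rewrite big_split /= IH !big_ord_recr /=.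
have -> : \sum_(1 <= u < n.+1) \sum_(i < n.+1 - u) (X i (i + u)%N + X (i + u)%N i) =
    \sum_(1 <= u < n) \sum_(i < n - u) (X i (i + u)%N + X (i + u)%N i)
    + \sum_(i < n) (X i n + X n i).
  transitivity (\sum_(1 <= u < n.+1) \sum_(i < n - u) (X i (i + u)%N + X (i + u)%N i)
      + \sum_(1 <= u < n.+1) (X (n - u)%N n + X n (n - u)%N)).
    rewrite -big_split /=; apply: eq_big_nat => u /andP[u0 un].
    by rewrite subSn // big_ord_recr /= subnK.
  congr (_ + _).
    case: (n) => [|p]; first by rewrite !big_geq.
    by rewrite big_nat_recr //= subnn big_ord0 addr0.
  rewrite big_add1 /= big_nat_rev /= add0n big_mkord.
  apply: eq_bigr => i _; have -> : (n - (n - i.+1).+1)%N = i by have := ltn_ord i; lia.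
  by [].
rewrite big_split /=; ring.
Qed.

End iota_means.

Section arcs.
Context {R : realType} {G : finZmodType} (pt : int -> int -> G).
Hypothesis ptD : forall a b c d, pt (a + c) (b + d) = pt a b + pt c d.
Implicit Types (L M : R) (F : G -> R).

Lemma ptB a b c d : pt (a - c) (b - d) = pt a b - pt c d.
Proof. by apply/eqP; rewrite -subr_eq opprK -ptD !subrK. Qed.

Definition arc L (T n w : nat) : seq G :=
  [seq pt (T + i)%:Z (lattice_height L (T + i)%:Z + j%:Z) | i <- iota 0 n, j <- iota 0 w].

Definition square (n : nat) : seq G :=
  [seq pt i%:Z j%:Z | i <- iota 0 n, j <- iota 0 n].

Lemma mean_arc L T n w (c : G -> R) :
  mean (arc L T n w) c =
  mean (iota 0 n) (fun i => mean (iota 0 w) (fun j =>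
     c (pt (T + i)%:Z (lattice_height L (T + i)%:Z + j%:Z)))).
Proof. exact: mean_allpairs. Qed.

Let bound_arith (K k u0 : R) : 1 <= k -> k <= K -> u0 * k = K ->
  K * (2 * k ^+ 2) + u0 * (4 * K * k ^+ 2) + K * (60 * k * K) <= 66 * (K ^+ 2 * k).
Proof.
move=> k1 kK e; have -> : u0 * (4 * K * k ^+ 2) = 4 * (K ^+ 2 * k) by rewrite -e; ring.
have : 0 <= (K - k) * (K * k) by rewrite !mulr_ge0; lra.
lra.
Qed.

(** With [K := k ^ 5 * b], the trivial bound is [2 * K ^ 2 * k ^ 2 * M]: a factor of order [k] is
    gained. Pairs of columns at distance below [k ^ 4 * b] are few enough to be bounded
    trivially. *)
Lemma arc_diffs_shift (k b T : nat) L (h : int) (C : int -> int -> R) M :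
  (4 <= k)%N -> (0 < b)%N -> (T + k ^ 5 * b <= k ^ 6 * b)%N ->
  (k ^ 7 * b)%:R <= L <= 2 * (k ^ 7 * b)%:R ->
  `|h| <= (k * b)%:Z -> (forall y z, `|C y z| <= M) ->
  let g i := lattice_height L (T + i)%:Z in
  let Z (i j w w' : nat) : R := C (i%:Z - j%:Z) (g i - g j + (w%:Z - w'%:Z))
     - C (i%:Z - j%:Z) (g i - g j + (w%:Z - w'%:Z) + h) in
  (`|\sum_(i < k ^ 5 * b) \sum_(j < k ^ 5 * b) \sum_(w < k) \sum_(w' < k) Z i j w w'|
    <= 66 * ((k ^ 5 * b)%:R ^+ 2 * k%:R) * M)%R : Prop.
Proof.
move=> k4 b0 TK Lk hk CM g Z.
have M0 : 0 <= M by apply: le_trans (CM 0 0); rewrite normr_ge0.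
set K := (k ^ 5 * b)%N in TK *.
have K0 : (0 < K)%N by rewrite muln_gt0 expn_gt0 b0 andbT; lia.
pose u0 := (k ^ 4 * b)%N.
have u0K : (u0 * k)%N = K by rewrite /u0 /K (expnSr k 4) mulnAC.
pose X i j := \sum_(w < k) \sum_(w' < k) Z i j w w'.
have XM i j : `|X i j| <= 2 * k%:R ^+ 2 * M.
  apply: le_trans (ler_norm_sum _ _ _) _.
  apply: le_trans (ler_sum _ (_ : forall w : 'I_k, true -> _ <= k%:R * (2 * M))) _.
    move=> w _; apply: le_trans (ler_norm_sum _ _ _) _.
    apply: le_trans (ler_sum _ (_ : forall w' : 'I_k, true -> _ <= 2 * M)) _.
      move=> w' _; apply: le_trans (ler_normB _ _) _.
      by rewrite mulr_natl mulr2n lerD.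
    by rewrite sumr_const card_ord -[_ *+ k]mulr_natl.
  by rewrite sumr_const card_ord -[_ *+ k]mulr_natl expr2 le_eqVlt; apply/orP; left; apply/eqP; ring.
have far u : (u0 <= u < K)%N ->
    `|\sum_(i < K - u) (X i (i + u)%N + X (i + u)%N i)| <= 60 * k%:R * K%:R * M.
  move=> /andP[u0u uK].
  have uu : (k ^ 4 * b <= u <= k ^ 5 * b)%N by rewrite u0u ltnW.
  pose psi i := g i - g (i + u)%N.
  have psiE : psi =1 (fun i => lattice_height L (T + i)%:Z - lattice_height L (T + i + u)%:Z).
    by move=> i; rewrite /psi /g addnA.
  (* One of [w] and [w'] is frozen, the other being the thickness in [curvature_sum]. For the
     opposite horizontal difference the vertical axis is reversed, whence the use of [- h]. *)
  have one (c : nat -> int -> R) (e : int) : `|e| <= (k * b)%:Z ->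
      (forall w z, `|c w z| <= M) ->
      `|\sum_(w < k) \sum_(i < K - u) \sum_(w' < k)
          (c w (psi i + w'%:Z) - c w (psi i + w'%:Z + e))| <= k%:R * (30 * K%:R * M).
    move=> he cM; apply: le_trans (ler_norm_sum _ _ _) _.
    rewrite -[in leRHS](card_ord k) mulr_natl -sumr_const; apply: ler_sum => w _.
    have := curvature_sum psiE k4 b0 TK Lk uu he (cM w).
    by rewrite pair_bigA.
  rewrite big_split /=; apply: le_trans (ler_normD _ _) _.
  have -> : 60 * k%:R * K%:R * M = k%:R * (30 * K%:R * M) + k%:R * (30 * K%:R * M) by ring.
  apply: lerD.
    have := one (fun w' v => C (- u%:Z) (v - w'%:Z)) h hk (fun w z => CM _ _).
    congr (`|_| <= _); rewrite exchange_big /=; apply: eq_bigr => i _.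
    rewrite exchange_big /=; apply: eq_bigr => w _; apply: eq_bigr => w' _.
    rewrite /Z /psi; congr (_ - _); congr C; rewrite ?PoszD; ring.
  have nh : `|- h| <= (k * b)%:Z by rewrite normrN.
  have := one (fun w v => C u%:Z (w%:Z - v)) (- h) nh (fun w z => CM _ _).
  congr (`|_| <= _); rewrite exchange_big /=; apply: eq_bigr => i _.
  apply: eq_bigr => w _; apply: eq_bigr => w' _.
  rewrite /Z /psi; congr (_ - _); congr C; rewrite ?PoszD; ring.
rewrite -[X in `|X|]/(\sum_(i < K) \sum_(j < K) X i j) sum_pairs_by_distance.
apply: le_trans (ler_normD _ _) _.
(* The three terms come from equal columns, from columns closer than [u0], and from the others. *)
apply: (@le_trans _ _ ((K%:R * (2 * k%:R ^+ 2) + u0%:R * (4 * K%:R * k%:R ^+ 2)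
   + K%:R * (60 * k%:R * K%:R)) * M)); last first.
  rewrite ler_wpM2r // bound_arith //; first by rewrite ler1n; lia.
    by rewrite ler_nat -u0K leq_pmull // muln_gt0 expn_gt0 b0 andbT; lia.
  by rewrite -natrM u0K.
rewrite -addrA mulrDl; apply: lerD.
  apply: le_trans (ler_norm_sum _ _ _) _.
  apply: (@le_trans _ _ (\sum_(i < K) (2 * k%:R ^+ 2 * M))).
    by apply: ler_sum.
  by rewrite sumr_const card_ord -[_ *+ K]mulr_natl mulrA.
have u0le : (u0 <= K)%N by rewrite -u0K leq_pmulr //; lia.
have u00 : (1 <= u0)%N by rewrite muln_gt0 expn_gt0 b0 andbT; lia.
rewrite (big_cat_nat (n := u0)) //= mulrDl; apply: le_trans (ler_normD _ _) _; apply: lerD.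
  apply: le_trans (ler_norm_sum _ _ _) _.
  apply: (@le_trans _ _ (\sum_(1 <= u < u0) (4 * K%:R * k%:R ^+ 2 * M))).
    apply: ler_sum => u _; apply: le_trans (ler_norm_sum _ _ _) _.
    apply: (@le_trans _ _ (\sum_(i < K - u) (4 * k%:R ^+ 2 * M))).
      apply: ler_sum => i _; apply: le_trans (ler_normD _ _) _.
      have := XM i (i + u)%N; have := XM (i + u)%N i; lra.
    rewrite sumr_const card_ord -[_ *+ (K - u)]mulr_natl.
    have -> : 4 * K%:R * k%:R ^+ 2 * M = K%:R * (4 * k%:R ^+ 2 * M) by ring.
    by rewrite ler_wpM2r ?ler_nat ?leq_subr // !mulr_ge0 ?sqr_ge0.
  rewrite sumr_const_nat -[_ *+ (u0 - 1)]mulr_natl -[leRHS]mulrA ler_wpM2r ?ler_nat ?leq_subr //.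
  by rewrite !mulr_ge0 ?sqr_ge0 ?ler0n.
apply: le_trans (ler_norm_sum _ _ _) _.
apply: (@le_trans _ _ (\sum_(u0 <= u < K) (60 * k%:R * K%:R * M))).
  by rewrite big_nat [leRHS]big_nat; apply: ler_sum => u hu; exact: far.
rewrite sumr_const_nat -[_ *+ (K - u0)]mulr_natl -[leRHS]mulrA ler_wpM2r ?ler_nat ?leq_subr //.
by rewrite !mulr_ge0 ?sqr_ge0 ?ler0n.
Qed.

End arcs.

(** * From the differences of a set to correlations along the set *)

Section mean_corr_shift.
Context {R : realFieldType} {G : finZmodType}.
Implicit Types (F : G -> R) (s : seq G).

(** The left side is the pairing of [F] with [W], the average over [s] minus its translate by [h].
    Cauchy-Schwarz brings in the squared norm of [W], which is the left side of the hypothesis and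
    involves only differences of points of [s]. *)
Lemma mean_corr_shift_le s (h : G) F (e : R) : 0 < e ->
  2 * mean (diffs s) (fun z => corr F z - corr F (z + h)) <= e ^+ 2 * corr F 0 ->
  `|mean s (corr F) - mean s (fun y => corr F (y + h))| <= e * corr F 0.
Proof.
move=> e0 small; pose W x := average s F x - average s F (x + h).
have avgE H v : mean s (fun y => \sum_x H x * F (x + y + v)) = \sum_x H x * average s F (x + v).
  rewrite mean_sum; apply: eq_bigr => x _; rewrite meanZ; congr (_ * _).
  by apply: eq_mean => y; rewrite addrAC.
have W2 : \sum_x W x ^+ 2 = 2 * mean (diffs s) (fun z => corr F z - corr F (z + h)).
  have E v : mean (diffs s) (fun z => corr F (z + v)) =
      \sum_x average s F x * average s F (x + v).
    transitivity (mean (diffs s) (fun z => \sum_x F x * (fun y => F (y + v)) (x + z))).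
      by apply: eq_mean => z; apply: eq_bigr => x _; rewrite addrA.
    rewrite (mean_diffs s F (fun y => F (y + v))); apply: eq_bigr => x _; congr (_ * _).
    by apply: eq_mean => y; rewrite addrAC.
  have E0 : mean (diffs s) (corr F) = \sum_x average s F x * average s F x.
    by rewrite mean_diffs_corr; apply: eq_bigr => x _; rewrite expr2.
  rewrite meanB E E0 mulrBr.
  transitivity (\sum_x average s F x * average s F x
     + \sum_x average s F (x + h) * average s F (x + h)
     - 2 * \sum_x average s F x * average s F (x + h)).
    by rewrite mulr_sumr -big_split -sumrB; apply: eq_bigr => x _ /=; rewrite /W; ring.
  by rewrite (sum_shift (fun x => average s F x * average s F x)); ring.
have FW : mean s (corr F) - mean s (fun y => corr F (y + h)) = \sum_x F x * W x.
  have -> : mean s (corr F) = \sum_x F x * average s F x.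
    transitivity (mean s (fun y => \sum_x F x * F (x + y + 0))).
      by apply: eq_mean => y; apply: eq_bigr => x _; rewrite addr0.
    by rewrite avgE; apply: eq_bigr => x _; rewrite addr0.
  under [RHS]eq_bigr do rewrite mulrBr.
  rewrite !sumrB; congr (_ - _); rewrite -avgE; apply: eq_mean => y.
  by apply: eq_bigr => x _; rewrite addrA.
(* Cauchy-Schwarz without square roots; the signs [d] = 1 and [d] = -1 give the two sides of the
   absolute value. *)
have amgm (d : R) : d ^+ 2 = 1 -> 2 * e * (d * \sum_x F x * W x) <= 2 * e ^+ 2 * corr F 0.
  move=> d2; have : 0 <= \sum_x (e * F x - d * W x) ^+ 2.
    by apply: sumr_ge0 => x _; rewrite sqr_ge0.
  have -> : \sum_x (e * F x - d * W x) ^+ 2 =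
     e ^+ 2 * corr F 0 - 2 * e * (d * \sum_x F x * W x) + d ^+ 2 * \sum_x W x ^+ 2.
    rewrite /corr !mulr_sumr -sumrB -big_split; apply: eq_bigr => x _ /=; rewrite addr0; ring.
  rewrite d2 W2; lra.
have e2 : 0 < 2 * e by rewrite mulr_gt0.
rewrite FW ler_norml; apply/andP; split; rewrite -(ler_pM2l e2).
  by have := amgm (-1) (etrans (sqrrN _) (expr1n _ _)); lra.
by have := amgm 1 (expr1n _ _); lra.
Qed.

End mean_corr_shift.

Section arcs.
Context {R : realType} {G : finZmodType} (pt : int -> int -> G).
Hypothesis ptD : forall a b c d, pt (a + c) (b + d) = pt a b + pt c d.
Implicit Types (L M : R) (F : G -> R).

Lemma size_arc L T n w : size (arc pt L T n w) = (n * w)%N.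
Proof. by rewrite size_allpairs !size_iota. Qed.

Lemma mean_diffs_arc L T n w (c : G -> R) :
  mean (diffs (arc pt L T n w)) c =
  (\sum_(i < n) \sum_(j < n) \sum_(v < w) \sum_(v' < w)
     c (pt (i%:Z - j%:Z) (lattice_height L (T + i)%:Z - lattice_height L (T + j)%:Z
        + (v%:Z - v'%:Z)))) / (n%:R ^+ 2 * w%:R ^+ 2).
Proof.
rewrite mean_allpairs mean_arc mean_iota.
under eq_bigr do rewrite mean_iota.
under eq_bigr => i _ do under eq_bigr => v _ do rewrite mean_arc mean_iota.
under eq_bigr => i _ do under eq_bigr => v _ do
  under eq_bigr => j _ do rewrite mean_iota.
rewrite -mulr_suml.
under eq_bigr => i _ do rewrite -mulr_suml.
rewrite -mulr_suml.
under eq_bigr => i _ do under eq_bigr => v _ do rewrite -mulr_suml.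
under eq_bigr => i _ do rewrite -mulr_suml.
rewrite -mulr_suml -!mulrA; congr (_ * _); last by rewrite -!invfM; congr _^-1; ring.
apply: eq_bigr => i _; rewrite exchange_big; apply: eq_bigr => j _.
apply: eq_bigr => v _; apply: eq_bigr => v' _; congr c.
by rewrite -(ptB ptD); congr pt; rewrite ?PoszD; ring.
Qed.

(** Divided by the number of pairs of points, the bound of [arc_diffs_shift] is [66 / k]; the factor
    2 of [mean_corr_shift_le] makes 132. *)
Lemma arc_corr_shift (k b T : nat) L (h : int) F (e : R) :
  (4 <= k)%N -> (0 < b)%N -> (T + k ^ 5 * b <= k ^ 6 * b)%N ->
  (k ^ 7 * b)%:R <= L <= 2 * (k ^ 7 * b)%:R ->
  `|h| <= (k * b)%:Z -> 0 < e -> 132 <= e ^+ 2 * k%:R ->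
  let s := arc pt L T (k ^ 5 * b) k in
  (`|mean s (corr F) - mean s (fun y => corr F (y + pt 0 h))| <= e * corr F 0)%R : Prop.
Proof.
move=> k4 b0 TK Lk hk e0 ek s; apply: mean_corr_shift_le => //.
rewrite mean_diffs_arc.
have /= := arc_diffs_shift k4 b0 TK Lk hk (fun y z => corr_norm_le F (pt y z)).
set S := \sum_(i < _) _; set S' := \sum_(i < _) _.
have -> : S' = S.
  do 4 (apply: eq_bigr => ? _); congr (_ - _); congr corr.
  by rewrite -ptD addr0.
rewrite ler_norml => /andP[_ hS].
have M0 : 0 <= corr F 0 by apply: le_trans (corr_norm_le F 0); rewrite normr_ge0.
have k0 : 0 < k%:R :> R by rewrite ltr0n; lia.
have K0 : 0 < (k ^ 5 * b)%:R :> R by rewrite ltr0n muln_gt0 expn_gt0 b0 andbT; lia.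
set K := (k ^ 5 * b)%:R in hS K0 *.
rewrite mulrA ler_pdivrMr ?mulr_gt0 ?exprn_gt0 //.
have p0 : 0 <= corr F 0 * (K ^+ 2 * k%:R) by rewrite !mulr_ge0 ?sqr_ge0 // ltW.
have := ler_wpM2r p0 ek; lra.
Qed.

Lemma mean_thick_arc L T n (k b : nat) (c : G -> R) :
  mean (arc pt L T n (k * b)) c =
  mean (iota 0 b) (fun j => mean (arc pt L T n k) (fun y => c (y + pt 0 (k * j)%:Z))).
Proof.
rewrite mean_arc [RHS](eq_mean _ (fun j => mean_arc pt L T n k _)).
rewrite [RHS]mean_exchange; apply: eq_mean => i.
rewrite mean_iota_mul; apply: eq_mean => j; apply: eq_mean => v; congr c.
by rewrite -ptD addr0; congr pt; rewrite PoszD; ring.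
Qed.

(** A thick arc is a stack of [b] thin ones, and each vertical shift costs at most
    [e * corr F 0]. *)
Lemma thin_thick_corr (k b T : nat) L F (e : R) :
  (4 <= k)%N -> (0 < b)%N -> (T + k ^ 5 * b <= k ^ 6 * b)%N ->
  (k ^ 7 * b)%:R <= L <= 2 * (k ^ 7 * b)%:R ->
  0 < e -> 132 <= e ^+ 2 * k%:R ->
  mean (arc pt L T (k ^ 5 * b) (k * b)) (corr F) - e * corr F 0
    <= mean (arc pt L T (k ^ 5 * b) k) (corr F).
Proof.
move=> k4 b0 TK Lk e0 ek; rewrite mean_thick_arc lerBlDr.
rewrite -[leRHS](mean_const _ (_ : 0 < size (iota 0 b))%N) ?size_iota //.
apply: ler_mean => j; rewrite mem_iota add0n => /= jb.
have hj : `|(k * j)%:Z| <= (k * b)%:Z by rewrite ger0_norm // lez_nat leq_mul2l ltnW // orbT.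
have /= := arc_corr_shift F k4 b0 TK Lk hj e0 ek.
by rewrite ler_norml => /andP[h _]; lra.
Qed.

Lemma square_refines a m : refines (R := R) (square pt (a * m)) (square pt a)
  [seq pt (a * i)%:Z (a * j)%:Z | i <- iota 0 m, j <- iota 0 m].
Proof.
move=> c; rewrite !mean_allpairs.
under [RHS]eq_mean => i do under eq_mean => j do rewrite mean_allpairs.
rewrite mean_iota_mul; apply: eq_mean => i.
rewrite [RHS]mean_exchange; apply: eq_mean => i'.
rewrite mean_iota_mul; apply: eq_mean => j; apply: eq_mean => j'.
by rewrite -ptD; congr c; congr pt; rewrite PoszD addrC.
Qed.

Lemma mean_window_shift n (c : int -> R) M (e : int) : (0 < n)%N ->
  (forall z, `|c z| <= M) ->
  `|mean (iota 0 n) (fun i => c (i%:Z + e)) - mean (iota 0 n) (fun i => c i%:Z)|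
     <= 2 * `|e|%:~R / n%:R * M.
Proof.
move=> n0 cM; rewrite !mean_iota -mulrBl normrM [`|_^-1|]gtr0_norm ?invr_gt0 ?ltr0n //.
rewrite mulrAC ler_wpM2r ?invr_ge0 ?ler0n //; exact: window_shift.
Qed.

Lemma mean_diffs_square_shift a (y z : int) (c : G -> R) M : (0 < a)%N ->
  (forall x, `|c x| <= M) ->
  `|mean (diffs (square pt a)) (fun h => c (pt y z + h)) - mean (diffs (square pt a)) c|
    <= 2 * (`|y| + `|z|)%:~R / a%:R * M.
Proof.
move=> a0 cM.
have dE (d : G -> R) : mean (diffs (square pt a)) d =
    mean (square pt a) (fun w => mean (square pt a) (fun v => d (v - w))).
  by rewrite [LHS]mean_allpairs mean_exchange.
rewrite !dE.
have ia : (0 < size (iota 0 a))%N by rewrite size_iota.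
have s0 : (0 < size (square pt a))%N by rewrite size_allpairs !size_iota muln_gt0 a0.
rewrite -meanB; apply: mean_norm_le => // w _.
rewrite !mean_allpairs.
pose f (u v : int) := c (pt u v - w).
have E (i j : nat) : c (pt y z + (pt i j - w)) = f (i%:Z + y) (j%:Z + z).
  by rewrite /f ptD addrA [pt y z + _]addrC.
rewrite (eq_mean _ (fun i => eq_mean _ (fun j => E i j))).
have -> : 2 * (`|y| + `|z|)%:~R / a%:R * M =
    2 * `|y|%:~R / a%:R * M + 2 * `|z|%:~R / a%:R * M by rewrite intrD; ring.
rewrite -(subrK (mean (iota 0 a) (fun i => mean (iota 0 a) (fun j => f i%:Z (j%:Z + z))))
  (mean _ (fun i => mean _ (fun j => f (i%:Z + y) _)))) -addrA.
apply: le_trans (ler_normD _ _) _; apply: lerD.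
  apply: (@mean_window_shift _ (fun i => mean (iota 0 a) (fun j => f i (j%:Z + z)))) => // i.
  by apply: mean_norm_le => // j _; exact: cM.
rewrite -meanB; apply: mean_norm_le => // i _.
by apply: (@mean_window_shift _ (fun j => f i%:Z j)) => // j; exact: cM.
Qed.

End arcs.

Section heights.
Context {R : realType}.
Implicit Types (L : R).

Lemma lattice_height_ge0 L t : 0 <= lattice_height L t.
Proof. by rewrite /lattice_height floor_ge0 sqrtr_ge0. Qed.

Lemma lattice_height_le L t : 0 <= L -> (lattice_height L t)%:~R <= L.
Proof.
move=> L0; have /andP[_ h] := lattice_height_itv L t.
exact: le_trans h (circle_height_le _ L0).
Qed.

(** The floors of two reals at distance at most an integer differ by less than that integer plus 1,
    so rounding costs nothing. *)
Lemma lattice_height_lip L (s t : int) : 0 < L ->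
  0 <= s -> 0 <= t -> s%:~R <= L / 2 -> t%:~R <= L / 2 ->
  `|lattice_height L s - lattice_height L t| <= `|s - t|.
Proof.
move=> L0 s0 t0 sL tL.
have := @circle_height_lip R L s%:~R t%:~R L0; rewrite !ler0z s0 t0 sL tL => /(_ isT isT).
rewrite -intrB -intr_norm ler_norml => /andP[h1 h2].
have /andP[a1 a2] := lattice_height_itv L s; have /andP[b1 b2] := lattice_height_itv L t.
rewrite ler_norml; apply/andP; split; rewrite -ltzD1 -(ltr_int R) !intrD ?rmorphN /=; lra.
Qed.

End heights.

Section arcs.
Context {R : realType} {G : finZmodType} (pt : int -> int -> G).
Hypothesis ptD : forall a b c d, pt (a + c) (b + d) = pt a b + pt c d.
Implicit Types (L M : R) (F : G -> R).

Let a_bound (t v k b : nat) : (4 <= k)%N -> (t <= k ^ 6 * b)%N ->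
  (v <= 2 * (k ^ 7 * b) + k * b)%N -> (t + v <= 4 * (k ^ 7 * b))%N.
Proof.
move=> k4 h1 h2.
have : (k ^ 6 * b <= k ^ 7 * b)%N by rewrite leq_mul2r leq_pexp2l ?orbT //; lia.
have : (k * b <= k ^ 7 * b)%N by rewrite leq_mul2r -{1}(expn1 k) leq_pexp2l ?orbT //; lia.
lia.
Qed.

(** The coordinates of a point of the arc add up to at most [4 * (k ^ 7 * b)], smaller than the side
    of the square by a factor of order [k]. *)
Lemma square_absorbs_arc (k b T : nat) L (c : G -> R) M :
  (4 <= k)%N -> (0 < b)%N -> (T + k ^ 5 * b <= k ^ 6 * b)%N ->
  (k ^ 7 * b)%:R <= L <= 2 * (k ^ 7 * b)%:R ->
  (forall z, `|c z| <= M) ->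
  `|mean (arc pt L T (k ^ 5 * b) (k * b))
      (fun y => mean (diffs (square pt (k ^ 8 * b))) (fun h => c (y + h)))
     - mean (diffs (square pt (k ^ 8 * b))) c| <= 8 / k%:R * M.
Proof.
move=> k4 b0 TK /andP[L1 L2] cM; set a := (k ^ 8 * b)%N.
have kp n : (0 < k ^ n)%N by rewrite expn_gt0; apply/orP; left; lia.
have a0 : (0 < a)%N by rewrite muln_gt0 kp.
have M0 : 0 <= M by apply: le_trans (cM 0); rewrite normr_ge0.
have s0 : (0 < size (arc pt L T (k ^ 5 * b) (k * b)))%N.
  have K0 : (0 < k ^ 5 * b)%N by rewrite muln_gt0 kp.
  have kb0 : (0 < k * b)%N by rewrite muln_gt0 b0 andbT; lia.
  by rewrite size_arc muln_gt0 K0.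
rewrite -[X in _ - X](mean_const _ s0) -meanB; apply: mean_norm_le => // y.
move=> /allpairsP[[i j] [/= iK jk ->]].
apply: le_trans (mean_diffs_square_shift ptD _ _ a0 cM) _.
rewrite ler_wpM2r //.
rewrite !mem_iota !add0n /= in iK jk.
have g0 := lattice_height_ge0 L (T + i)%:Z.
have L0 : 0 <= L by apply: le_trans L1; rewrite ler0n.
have gL := lattice_height_le (T + i)%:Z L0.
set g := lattice_height _ _ in g0 gL *.
have gN : (absz g)%:Z = g by lia.
have g2 : (absz g <= 2 * (k ^ 7 * b))%N.
  rewrite -(ler_nat R) natrM (le_trans _ L2) //; apply: le_trans gL.
  by rewrite -[in leRHS]gN -pmulrn.
have tv : (T + i + (absz g + j) <= 4 * (k ^ 7 * b))%N.
  apply: a_bound => //; first by apply: leq_trans TK; rewrite leq_add2l ltnW.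
  by apply: leq_add => //; exact: ltnW.
have -> : `|(T + i)%:Z| + `|g + j%:Z| = (T + i + (absz g + j))%:Z :> int.
  by rewrite !ger0_norm ?addr_ge0 // !PoszD gN.
rewrite -pmulrn ler_pdivrMr ?ltr0n //.
apply: (@le_trans _ _ (2 * (4 * (k ^ 7 * b))%:R)); first by rewrite ler_wpM2l // ler_nat.
have k0 : k%:R != 0 :> R by rewrite pnatr_eq0; lia.
rewrite le_eqVlt; apply/orP; left; apply/eqP.
have kE m : (k ^ m * b)%:R = k%:R ^+ m * b%:R :> R by rewrite natrM natrX.
by rewrite /a natrM !kE; field.
Qed.

(** A shift by at most [b] is small against both dimensions of the arc, [k ^ 5 * b] columns of
    height [k * b]. The bound [k ^ 5 * b <= T] keeps the shifted abscissae nonnegative. *)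
Lemma arc_absorbs_square (k b T : nat) L (c : G -> R) M :
  (4 <= k)%N -> (0 < b)%N -> (k ^ 5 * b <= T)%N -> (T + k ^ 5 * b <= k ^ 6 * b)%N ->
  (k ^ 7 * b)%:R <= L -> (forall z, `|c z| <= M) ->
  `|mean (arc pt L T (k ^ 5 * b) (k * b)) c
     - mean (arc pt L T (k ^ 5 * b) (k * b))
        (fun y => mean (diffs (square pt b)) (fun h => c (y + h)))| <= 8 / k%:R * M.
Proof.
move=> k4 b0 KT TK L1 cM.
have kp n : (0 < k ^ n)%N by rewrite expn_gt0; apply/orP; left; lia.
have M0 : 0 <= M by apply: le_trans (cM 0); rewrite normr_ge0.
set K := (k ^ 5 * b)%N in KT TK *.
have K0 : (0 < K)%N by rewrite muln_gt0 kp.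
have bK : (b <= K)%N by rewrite leq_pmull.
have kb0 : (0 < k * b)%N by rewrite muln_gt0 b0 andbT; lia.
have L0 : 0 < L by apply: lt_le_trans L1; rewrite ltr0n muln_gt0 kp.
have half : (k ^ 6 * b + b)%:R <= L / 2.
  rewrite ler_pdivlMr //; apply: le_trans L1; rewrite -natrM ler_nat.
  have : (b <= k ^ 6 * b)%N by rewrite leq_pmull.
  have : (4 * (k ^ 6 * b) <= k ^ 7 * b)%N by rewrite (expnS k 6) -mulnA leq_mul2r k4 orbT.
  lia.
have d0 : (0 < size (diffs (square pt b)))%N by rewrite !size_allpairs !size_iota !muln_gt0 b0.
rewrite mean_exchange -[X in `|X - _|](mean_const _ d0) -meanB; apply: mean_norm_le => // h.
move=> /allpairsP[[y z] [/= /allpairsP[[i1 j1] [/= i1b j1b ->]] /allpairsP[[i2 j2] [/= i2b j2b ->]] ->]].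
rewrite !mem_iota !add0n /= in i1b j1b i2b j2b.
rewrite -(ptB ptD); set h1 : int := _ - _; set h2 : int := _ - _.
have h1b : `|h1| <= b%:Z by rewrite /h1; lia.
have h2b : `|h2| <= b%:Z by rewrite /h2; lia.
rewrite !mean_arc.
pose g t := lattice_height L t.
pose f (u v : int) := c (pt u v).
(* The translated column at abscissa [T%:Z + u] comes from [T%:Z + u - h1]. A window shift in [u]
   undoes the horizontal motion; the base of each column is then off by at most [2 * b]. *)
pose Phi (u : int) := mean (iota 0 (k * b)) (fun w => f (T%:Z + u) (w%:Z + (g (T%:Z + u - h1) + h2))).
have fM u v : `|f u v| <= M by exact: cM.
have kbs : (0 < size (iota 0 (k * b)))%N by rewrite size_iota.
have Ks : (0 < size (iota 0 K))%N by rewrite size_iota.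
have PhiM u : `|Phi u| <= M by apply: mean_norm_le.
have E1 : mean (iota 0 K) (fun i => mean (iota 0 (k * b)) (fun j =>
    c (pt (T + i)%:Z (lattice_height L (T + i)%:Z + j%:Z) + pt h1 h2)))
   = mean (iota 0 K) (fun i => Phi (i%:Z + h1)).
  apply: eq_mean => i; apply: eq_mean => j; rewrite -ptD /f /g.
  have -> : T%:Z + (i%:Z + h1) - h1 = T%:Z + i%:Z by ring.
  by rewrite PoszD; congr c; congr pt; ring.
rewrite E1 distrC.
rewrite -(subrK (mean (iota 0 K) (fun i => Phi i%:Z)) (mean (iota 0 K) (fun i => Phi (i%:Z + h1)))) -addrA.
apply: le_trans (ler_normD _ _) _.
have s1 := mean_window_shift h1 K0 PhiM.
have s2 : `|mean (iota 0 K) (fun i => Phi i%:Z)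
    - mean (iota 0 K) (fun i => mean (iota 0 (k * b)) (fun j =>
       c (pt (T + i)%:Z (lattice_height L (T + i)%:Z + j%:Z))))|
   <= 2 * (2 * b)%:R / (k * b)%:R * M.
  rewrite -meanB; apply: mean_norm_le => // i; rewrite mem_iota add0n /= => iK.
  pose e := g (T%:Z + i%:Z - h1) + h2 - g (T%:Z + i%:Z).
  have := mean_window_shift e kb0 (fun v => fM (T + i)%:Z (v + g (T%:Z + i%:Z))).
  rewrite (eq_mean _ (_ : _ =1 (fun w => f (T%:Z + i%:Z) (w%:Z + (g (T%:Z + i%:Z - h1) + h2))))); last first.
    by move=> w; rewrite -addrA /e subrK PoszD.
  rewrite (eq_mean (iota 0 (k * b)) (_ : (fun w : nat => f (T + i)%:Z (w%:Z + g (T%:Z + i%:Z))) =1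
    (fun j => c (pt (T + i)%:Z (lattice_height L (T + i)%:Z + j%:Z))))); last first.
    by move=> w; rewrite addrC /f /g PoszD.
  move=> hh; apply: le_trans hh _; rewrite ler_wpM2r // ler_wpM2r ?invr_ge0 ?ler0n // ler_wpM2l //.
  rewrite pmulrn ler_int.
  have ub (t : nat) : (t <= k ^ 6 * b + b)%N -> (t%:Z)%:~R <= L / 2.
    by move=> tb; apply: le_trans half; rewrite -pmulrn ler_nat.
  have lip : `|g (T%:Z + i%:Z - h1) - g (T%:Z + i%:Z)| <= `|h1|.
    have n1 : T%:Z + i%:Z - h1 = (absz (T%:Z + i%:Z - h1)%R)%:Z by move: h1b; lia.
    have := @lattice_height_lip R L (T%:Z + i%:Z - h1) (T%:Z + i%:Z) L0.
    have -> : T%:Z + i%:Z - h1 - (T%:Z + i%:Z) = - h1 by ring.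
    rewrite normrN; apply.
    - move: h1b; lia.
    - lia.
    - rewrite n1; apply: ub; move: h1b; lia.
    - rewrite -PoszD; apply: ub; lia.
  rewrite /e; move: lip h1b h2b; lia.
apply: le_trans (lerD s1 s2) _.
rewrite -mulrDl ler_wpM2r //.
have k0 : 0 < k%:R :> R by rewrite ltr0n; lia.
have bb0 : 0 < b%:R :> R by rewrite ltr0n.
apply: (@le_trans _ _ (2 * b%:R / (k * b)%:R + 2 * (2 * b)%:R / (k * b)%:R)).
  rewrite lerD2r; apply: ler_pM; rewrite ?mulr_ge0 ?invr_ge0 ?ler0n ?ler0z //.
    by rewrite ler_wpM2l // pmulrn ler_int.
  rewrite lef_pV2 ?posrE ?ltr0n // ler_nat /K leq_mul2r.
  by rewrite -{1}(expn1 k) leq_pexp2l ?orbT //; lia.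
rewrite -mulrDl ler_pdivrMr ?ltr0n // !natrM.
have -> : 8 / k%:R * (k%:R * b%:R) = 8 * b%:R :> R by field; rewrite gt_eqF.
lra.
Qed.

(** Every integer from 0 to [o + n] is the difference of at least [a - (o + n) >= a / 2] pairs,
    hence has probability at least [1 / (2 * a)]. *)
Let mean_diff_pairs_ge (a o n : nat) (phi : int -> R) : (0 < a)%N ->
  (2 * (o + n) <= a)%N -> (forall z, 0 <= phi z) ->
  \sum_(x < n) phi (o + x)%:Z <= 2 * a%:R *
    mean (iota 0 a) (fun i => mean (iota 0 a) (fun j => phi (i%:Z - j%:Z))).
Proof.
move=> a0 on phi0; have aR : 0 < a%:R :> R by rewrite ltr0n.
rewrite mean_exchange mean_iota; under [in leRHS]eq_bigr do rewrite mean_iota.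
rewrite -mulr_suml.
set S := \sum_(_ < _) \sum_(_ < _) _; set X := \sum_(_ < n) _.
have X0 : 0 <= X by apply: sumr_ge0.
have hS : (a - (o + n))%:R * X <= S.
  rewrite mulr_natl -[X in X *+ _ <= _]/X.
  have -> : S = \sum_(0 <= j < a) \sum_(0 <= i < a) phi (i%:Z - j%:Z).
    by rewrite big_mkord; apply: eq_bigr => j _; rewrite big_mkord.
  rewrite (big_cat_nat (n := a - (o + n))) ?leq_subr //=.
  rewrite -[leLHS]addr0; apply: lerD; last first.
    by apply: sumr_ge0 => j _; apply: sumr_ge0.
  rewrite -[(a - _)%N in leLHS]subn0 -sumr_const_nat.
  apply: ler_sum_nat => j /= ja.
  rewrite (big_cat_nat (n := (j + o)%N)) //=; last by lia.
  rewrite (big_cat_nat (n := (j + o + n)%N) (m := (j + o)%N)) //=; [|lia|lia].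
  rewrite -[leLHS]addr0 -[leLHS]add0r; apply: lerD; first exact: sumr_ge0.
  apply: lerD; last exact: sumr_ge0.
  rewrite -{1}[(j + o)%N]add0n big_addn addKn big_mkord /X.
  by rewrite le_eqVlt; apply/orP; left; apply/eqP; apply: eq_bigr => x _; congr phi; lia.
have h2 : a%:R / 2 * X <= S.
  apply: le_trans hS; rewrite ler_wpM2r // ler_pdivrMr // -natrM ler_nat; lia.
have -> : 2 * a%:R * (S / a%:R / a%:R) = 2 * S / a%:R by field; rewrite gt_eqF.
rewrite ler_pdivlMr //; lra.
Qed.

Let fit6 (k b T K : nat) : (4 <= k)%N -> (T + K <= k ^ 6 * b)%N -> (2 * (T + K) <= k ^ 8 * b)%N.
Proof.
move=> k4 h; apply: leq_trans (_ : 2 * (k ^ 6 * b) <= _)%N; first by rewrite leq_mul2l h orbT.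
by rewrite (expnD k 2 6) -mulnA leq_mul2r; apply/orP; right; rewrite expnS expn1; nia.
Qed.

Let fit7 (k b g : nat) : (8 <= k)%N -> (g <= 2 * (k ^ 7 * b))%N ->
  (2 * (g + k * b) <= k ^ 8 * b)%N.
Proof.
move=> k8 h.
have : (k * b <= k ^ 7 * b)%N by rewrite leq_mul2r -{1}(expn1 k) leq_pexp2l ?orbT //; lia.
have : (8 * (k ^ 7 * b) <= k ^ 8 * b)%N by rewrite (expnS k 7) -mulnA leq_mul2r k8 orbT.
lia.
Qed.

(** The coordinates on the arc are nonnegative and at most half the side [a := k ^ 8 * b], where a
    difference has density at least [1 / (2 * a)] in each coordinate. The constant is [(2 * a) ^ 2]
    divided by the size of the arc. *)
Lemma arc_dominated (k b T : nat) L :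
  (8 <= k)%N -> (0 < b)%N -> (T + k ^ 5 * b <= k ^ 6 * b)%N ->
  (k ^ 7 * b)%:R <= L <= 2 * (k ^ 7 * b)%:R ->
  dominated (4 * k%:R ^+ 10 : R) (arc pt L T (k ^ 5 * b) (k * b))
    (diffs (square pt (k ^ 8 * b))).
Proof.
move=> k8 b0 TK /andP[L1 L2] Phi Phi0; set a := (k ^ 8 * b)%N.
have k4 : (4 <= k)%N by lia.
have kp n : (0 < k ^ n)%N by rewrite expn_gt0; apply/orP; left; lia.
have a0 : (0 < a)%N by rewrite muln_gt0 kp.
have L0 : 0 <= L by apply: le_trans L1; rewrite ler0n.
pose Psi (u : int) := mean (iota 0 a) (fun i => mean (iota 0 a) (fun j => Phi (pt u (i%:Z - j%:Z)))).
have Psi0 u : 0 <= Psi u by apply: mean_ge0 => i _; apply: mean_ge0.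
have -> : mean (diffs (square pt a)) Phi =
    mean (iota 0 a) (fun i => mean (iota 0 a) (fun j => Psi (i%:Z - j%:Z))).
  rewrite mean_allpairs mean_allpairs; apply: eq_mean => i.
  under eq_mean => j do rewrite mean_allpairs.
  rewrite mean_exchange; apply: eq_mean => i'.
  apply: eq_mean => j; apply: eq_mean => j'; by rewrite (ptB ptD).
have h1 := mean_diff_pairs_ge a0 (fit6 k4 TK) Psi0.
set N := mean (iota 0 a) _ in h1 *.
set K := (k ^ 5 * b)%N in TK h1 *.
have h2 (x : nat) : \sum_(w < k * b) Phi (pt (T + x)%:Z (lattice_height L (T + x)%:Z + w%:Z))
    <= 2 * a%:R * Psi (T + x)%:Z.
  have g0 := lattice_height_ge0 L (T + x)%:Z.
  have gL := lattice_height_le (T + x)%:Z L0.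
  set g := lattice_height _ _ in g0 gL *.
  have gN : (absz g)%:Z = g by lia.
  have g2 : (absz g <= 2 * (k ^ 7 * b))%N.
    rewrite -(ler_nat R) natrM (le_trans _ L2) //; apply: le_trans gL.
    by rewrite -[in leRHS]gN -pmulrn.
  have := mean_diff_pairs_ge a0 (fit7 k8 g2) (fun z => Phi0 (pt (T + x)%:Z z)).
  by under eq_bigr do rewrite (PoszD (absz g)) gN.
have a2 : 0 <= 2 * a%:R :> R by rewrite mulr_ge0.
have h3 := ler_wpM2l a2 h1; rewrite mulr_sumr in h3.
have {}h3 := le_trans (ler_sum _ (fun (x : 'I_K) (_ : true) => h2 x)) h3.
rewrite mean_arc mean_iota; under eq_bigr do rewrite mean_iota.
rewrite -mulr_suml; set S := \sum_(_ < K) _ in h3 *.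
have K0 : 0 < K%:R :> R by rewrite ltr0n muln_gt0 kp.
have kb0 : 0 < (k * b)%:R :> R by rewrite ltr0n muln_gt0 b0 andbT; lia.
rewrite ler_pdivrMr // ler_pdivrMr //; apply: le_trans h3 _.
have kE m : (k ^ m * b)%:R = k%:R ^+ m * b%:R :> R by rewrite natrM natrX.
by rewrite le_eqVlt; apply/orP; left; apply/eqP; rewrite /a /K natrM !kE; ring.
Qed.

End arcs.

(** * The discrete theorem *)

Section scales.
Context {R : realType} {G : finZmodType} (pt : int -> int -> G).
Hypothesis ptD : forall a b c d, pt (a + c) (b + d) = pt a b + pt c d.
Implicit Types (L m e : R) (F : G -> R).

Definition arc_start_ok (k b T : nat) : bool :=
  (k ^ 5 * b <= T)%N && (T + k ^ 5 * b <= k ^ 6 * b)%N.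

Lemma size_square a : size (square pt a) = (a * a)%N.
Proof. by rewrite size_allpairs !size_iota. Qed.

Lemma box_form_arcs_ge (k b n : nat) (Ts : seq nat) L m e F :
  (8 <= k)%N -> (0 < b)%N -> size Ts = n -> all (arc_start_ok k b) Ts ->
  (k ^ 7 * b)%:R <= L <= 2 * (k ^ 7 * b)%:R ->
  admissible m F -> 0 <= m -> 0 < e -> 132 <= e ^+ 2 * k%:R ->
  let P := diffs (square pt (k ^ 8 * b)) in
  let Pb := diffs (square pt b) in
  (box_form (nseq n P) F
    - n%:R * ((e + 16 / k%:R) * m
       + (4 * k%:R ^+ 10) ^+ n.-1 * (box_form (nseq n Pb) F - box_form (nseq n P) F))
   <= box_form [seq arc pt L T (k ^ 5 * b) k | T <- Ts] F)%R : Prop.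
Proof.
move=> k8 b0 sn /allP Tok Lk Fm m0 e0 ek P Pb.
have k4 : (4 <= k)%N by lia.
have kp i : (0 < k ^ i)%N by rewrite expn_gt0; apply/orP; left; lia.
have kr : 1 <= k%:R :> R by rewrite ler1n; lia.
have ab : (0 < k ^ 8 * b)%N by rewrite muln_gt0 kp.
have K0 : (0 < k ^ 5 * b)%N by rewrite muln_gt0 kp.
have k0 : (0 < k)%N by lia.
have kb0 : (0 < k * b)%N by rewrite muln_gt0 k0.
have s0 a : (0 < a)%N -> (0 < size (square pt a))%N by move=> a0; rewrite size_square muln_gt0 a0.
have d0 a : (0 < a)%N -> (0 < size (diffs (square pt a)))%N.
  by move=> a0; rewrite size_allpairs muln_gt0 s0.
pose u := [seq pt (b * i)%:Z (b * j)%:Z | i <- iota 0 (k ^ 8), j <- iota 0 (k ^ 8)].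
have u0 : (0 < size u)%N by rewrite size_allpairs !size_iota muln_gt0 kp.
have ref : refines (R := R) (square pt (k ^ 8 * b)) (square pt b) u.
  by rewrite mulnC; exact: square_refines.
pose l := [seq (arc pt L T (k ^ 5 * b) k, arc pt L T (k ^ 5 * b) (k * b)) | T <- Ts].
have ln : size l = n by rewrite size_map.
have := @box_form_thin_ge R G m (4 * k%:R ^+ 10) e (8 / k%:R + 8 / k%:R) P Pb l F.
rewrite ln -[map fst l]map_comp.
have -> : 8 / k%:R + 8 / k%:R = 16 / k%:R :> R by rewrite -mulrDl; congr (_ / _); ring.
have B1 : 1 <= 4 * k%:R ^+ 10 :> R.
  have : 1 <= k%:R ^+ 10 :> R by rewrite exprn_ege1.
  lra.
have e2 : 0 <= 16 / k%:R :> R by rewrite divr_ge0.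
move=> /(_ Fm m0 B1 (ltW e0) e2 (d0 _ ab) (d0 _ b0)); apply.
- by move=> _ /mapP[T _ ->] /=; rewrite !size_arc; split; rewrite muln_gt0 K0.
- by move=> H; exact: mean_diffs_refines ref.
- move=> _ H /mapP[T /Tok /andP[T1 T2] ->] /=.
  exact: thin_thick_corr.
- move=> _ H /mapP[T /Tok /andP[T1 T2] ->] /=.
  have -> : 16 / k%:R = 8 / k%:R + 8 / k%:R :> R by rewrite -mulrDl; congr (_ / _); ring.
  apply: (mean_corr_ge H u0 _ _ ref) => //.
  + by rewrite size_arc muln_gt0 K0.
  + exact: s0.
  + move=> c M cM; apply: arc_absorbs_square => //; by have /andP[] := Lk.
  + by move=> c M cM; apply: square_absorbs_arc.
- by move=> _ /mapP[T /Tok /andP[T1 T2] ->] /=; exact: arc_dominated.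
Qed.

(** The sides [k ^ (8 * (J - j)) * b0] decrease to [b0], each tiling the previous one. The
    hypothesis says that, relative to [#|G|], the lower bound for cubes on squares exceeds all the
    losses. *)
Lemma exists_positive_scale (n k J b0 : nat) F e :
  (8 <= k)%N -> (0 < b0)%N -> (0 < J)%N -> 0 < e -> 132 <= e ^+ 2 * k%:R ->
  (forall x, 0 <= F x <= 1) ->
  n%:R * (e + 16 / k%:R + (4 * k%:R ^+ 10) ^+ n.-1 / J%:R)
    < (total F / #|G|%:R) ^+ (2 ^ n) ->
  exists2 j, (j < J)%N & let b := (k ^ (8 * (J - j.+1)) * b0)%N in
    forall L Ts, (k ^ 7 * b)%:R <= L <= 2 * (k ^ 7 * b)%:R ->
      size Ts = n -> all (arc_start_ok k b) Ts ->
      0 < box_form [seq arc pt L T (k ^ 5 * b) k | T <- Ts] F.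
Proof.
move=> k8 b00 J0 e0 ek F01 big.
have kp i : (0 < k ^ i)%N by rewrite expn_gt0; apply/orP; left; lia.
have c0 : 0 < #|G|%:R :> R by rewrite ltr0n; apply/card_gt0P; exists 0.
have Fm : admissible #|G|%:R F.
  split=> //; rewrite -sum1_card natr_sum; apply: ler_sum => x _.
  by have /andP[] := F01 x.
pose s j := (k ^ (8 * (J - j)) * b0)%N.
have s0 j : (0 < s j)%N by rewrite muln_gt0 kp.
have ss j : (j < J)%N -> s j = (k ^ 8 * s j.+1)%N.
  by move=> jJ; rewrite /s mulnA -expnD; congr (k ^ _ * _)%N; lia.
pose u j := [seq pt (s j.+1 * i)%:Z (s j.+1 * i')%:Z | i <- iota 0 (k ^ 8), i' <- iota 0 (k ^ 8)].
have [j jJ hj] := @exists_stable_scale R G (fun j => square pt (s j)) u J n _ F J0 Fm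
  (fun j => ltac:(by rewrite size_square muln_gt0 s0))
  (fun j => ltac:(by rewrite size_allpairs !size_iota muln_gt0 kp))
  (fun j jJ => ltac:(by rewrite /= (ss j jJ) mulnC; exact: square_refines)).
exists j => // b L Ts Lk sn Tok.
have b0' : (0 < b)%N by exact: s0.
have /= := box_form_arcs_ge k8 b0' sn Tok Lk Fm (ltW c0) e0 ek.
apply: lt_le_trans.
have P0 : (0 < size (square pt (k ^ 8 * b)))%N by rewrite -(ss j jJ) size_square muln_gt0 s0.
have := box_form_diffs_ge n P0 Fm.
rewrite ler_pdivlMr // => low.
rewrite (ss j jJ) in hj.
set X := box_form (nseq n (diffs (square pt (k ^ 8 * b)))) F in low hj *.
set Y := box_form _ _ in hj *.
have B0 : 0 <= (4 * k%:R ^+ 10) ^+ n.-1 :> R by rewrite exprn_ge0 // mulr_ge0 ?exprn_ge0.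
set B := (4 * k%:R ^+ 10) ^+ n.-1 in big B0 *.
have h1 : B * (Y - X) <= B * (#|G|%:R / J%:R) by rewrite ler_wpM2l.
have h2 : n%:R * (B * (Y - X)) <= n%:R * (B * (#|G|%:R / J%:R)) by rewrite ler_wpM2l.
have h3 : n%:R * (e + 16 / k%:R + B / J%:R) * #|G|%:R < (total F / #|G|%:R) ^+ (2 ^ n) * #|G|%:R.
  by rewrite ltr_pM2r.
rewrite subr_gt0; apply: le_lt_trans (lt_le_trans h3 low).
rewrite mulrDr; apply: le_trans (lerD (lexx _) h2) _.
by rewrite le_eqVlt; apply/orP; left; apply/eqP; ring.
Qed.

End scales.

(** The type ['Z_p.+2] has exactly [p.+2] elements, whereas ['Z_q] has two for [q] equal to 0 or
    1. *)
Definition torus (p : nat) : Type := ('Z_p.+2 * 'Z_p.+2)%type.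
HB.instance Definition _ p := GRing.Zmodule.on (torus p).
HB.instance Definition _ p := Finite.on (torus p).

Definition torus_point p (u v : int) : torus p := (u%:~R, v%:~R).

Lemma torus_pointD p (a b c d : int) :
  torus_point p (a + c) (b + d) = torus_point p a b + torus_point p c d.
Proof. by rewrite /torus_point !intrD. Qed.

Section discrete.
Context {R : realType}.

Lemma torus_point_sum p n (t v : nat -> nat) (r : nat -> bool) (x y : nat) :
  torus_point p x%:Z y%:Z + \sum_(i < n) torus_point p (t i)%:Z (v i)%:Z *+ r i =
  torus_point p (x + \sum_(i < n) t i * r i)%:Z (y + \sum_(i < n) v i * r i)%:Z.
Proof.
elim: n => [|n IH]; first by rewrite !big_ord0 addr0 !addn0.
rewrite !big_ord_recr /= addrA IH !addnA.
case: (r n); last by rewrite !muln0 !addn0 mulr0n addr0.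
by rewrite !muln1 mulr1n -torus_pointD !PoszD.
Qed.

Lemma torus_nat p (x : nat) : (x < p.+2)%N -> nat_of_ord (x%:Z%:~R : 'Z_p.+2) = x.
Proof. by move=> xp; rewrite -pmulrn val_Zp_nat // modn_small. Qed.

Lemma torus_pointK p (x : torus p) : torus_point p (nat_of_ord x.1)%:Z (nat_of_ord x.2)%:Z = x.
Proof. by case: x => a b; rewrite /torus_point -!pmulrn !natr_Zp. Qed.

Lemma card_torus p : #|{: torus p}| = (p.+2 ^ 2)%N.
Proof.
have -> : #|{: torus p}| = #|{: 'I_p.+2 * 'I_p.+2}| by [].
by rewrite card_prod card_ord expnS expn1.
Qed.

Let sum_bound (n Q c : nat) (t : nat -> nat) (r : nat -> bool) :
  (forall i, (i < n)%N -> t i <= c)%N -> (n * c <= Q)%N ->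
  (\sum_(i < n) t i * r i <= Q)%N.
Proof.
move=> tc nc; apply: leq_trans nc; rewrite -[X in (_ <= X * c)%N](card_ord n) -sum_nat_const.
apply: leq_sum => i _; apply: leq_trans (tc i (ltn_ord i)).
by case: (r i); rewrite ?muln1 ?muln0.
Qed.

Let height_bound (n k b P : nat) : (3 * n <= k)%N -> (0 < k)%N -> (0 < P)%N ->
  (n * (2 * (k ^ 7 * b) + k * b) <= k ^ 8 * (P * b))%N.
Proof.
move=> nk k0 P0.
have h1 : (k * b <= k ^ 7 * b)%N by rewrite leq_mul2r -{1}(expn1 k) leq_pexp2l ?orbT.
have h2 : (n * (2 * (k ^ 7 * b) + k * b) <= n * (3 * (k ^ 7 * b)))%N by rewrite leq_mul2l; lia.
apply: leq_trans h2 _; rewrite mulnA [(n * 3)%N]mulnC.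
apply: leq_trans (leq_mul nk (leqnn _)) _; rewrite mulnA -expnS leq_mul2l.
by rewrite leq_pmull // orbT.
Qed.

Let succ_le_4mul (c d : nat) : (0 < d -> c <= d -> c + 1 <= 4 * d)%N.
Proof. lia. Qed.

(** The torus has side [2 * Q] while [S] occupies one quarter of it: the edges of a cube add up to
    at most [Q] in each coordinate, by [3 * n <= k], so no vertex wraps around. [4 ^ n.+1 <= k]
    keeps the lacunary arcs below [k ^ 6 * b]. *)
Lemma discrete_hypercubes (n k J b0 : nat) (S : nat -> nat -> bool) (e : R) :
  (8 <= k)%N -> (4 ^ n.+1 <= k)%N -> (3 * n <= k)%N -> (0 < b0)%N -> (0 < J)%N ->
  0 < e -> 132 <= e ^+ 2 * k%:R ->
  let Q := (k ^ (8 * J) * b0)%N in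
  (forall i j, S i j -> (i < Q)%N && (j < Q)%N) ->
  n%:R * (e + 16 / k%:R + (4 * k%:R ^+ 10) ^+ n.-1 / J%:R)
    < ((\sum_(i < 2 * Q) \sum_(j < 2 * Q) (S i j)%:R) / (2 * Q)%:R ^+ 2) ^+ (2 ^ n) ->
  exists2 j, (j < J)%N & let b := (k ^ (8 * (J - j.+1)) * b0)%N in
    forall L : R, (k ^ 7 * b)%:R <= L <= 2 * (k ^ 7 * b)%:R ->
    exists x y : nat, exists t v : nat -> nat,
    [/\ forall i, (i < n)%N -> (4 ^ i.+1 * (k ^ 5 * b) <= t i <= (4 ^ i.+1).+1 * (k ^ 5 * b))%N,
        forall i, (i < n)%N -> `|(v i)%:R - circle_height L (t i)%:R| <= k%:R
      & forall r : nat -> bool,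
          S (x + \sum_(i < n) t i * r i)%N (y + \sum_(i < n) v i * r i)%N].
Proof.
move=> k8 k4n k3n b00 J0 e0 ek Q SQ big.
have k0 : (0 < k)%N by apply: leq_trans k8.
have kp i : (0 < k ^ i)%N by rewrite expn_gt0 k0.
have Q0 : (0 < Q)%N by rewrite muln_gt0 kp.
pose p := (2 * Q).-2; have pE : p.+2 = (2 * Q)%N by rewrite /p; lia.
pose F (x : torus p) : R := (S x.1 x.2)%:R.
have F01 x : 0 <= F x <= 1 by rewrite /F; case: (S _ _); rewrite /= ?lexx ler01.
have totF : total F = \sum_(i < 2 * Q) \sum_(j < 2 * Q) (S i j)%:R.
  by rewrite -pE (pair_bigA _ (fun i j : 'I_p.+2 => (S i j)%:R)).
have big' : n%:R * (e + 16 / k%:R + (4 * k%:R ^+ 10) ^+ n.-1 / J%:R)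
    < (total F / #|{: torus p}|%:R) ^+ (2 ^ n).
  by rewrite totF card_torus pE natrX.
have [j jJ hj] := exists_positive_scale (@torus_pointD p) k8 b00 J0 e0 ek F01 big'.
exists j => // b L Lk; have {}hj := hj L [seq (4 ^ i.+1 * (k ^ 5 * b))%N | i <- iota 0 n] Lk.
rewrite size_map size_iota in hj; have {}hj := hj erefl.
have b0' : (0 < b)%N by rewrite muln_gt0 kp.
have Tend i : (i < n)%N -> ((4 ^ i.+1).+1 * (k ^ 5 * b) <= k ^ 6 * b)%N.
  move=> iN; rewrite (expnS k 5) -mulnA leq_mul2r; apply/orP; right.
  apply: leq_trans k4n; rewrite -addn1 [in leqRHS]expnS.
  have : (4 ^ i.+1 <= 4 ^ n)%N by rewrite leq_exp2l.
  have : (0 < 4 ^ n)%N by rewrite expn_gt0.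
  exact: succ_le_4mul.
have Tok : all (arc_start_ok k b) [seq (4 ^ i.+1 * (k ^ 5 * b))%N | i <- iota 0 n].
  apply/allP => T /mapP[i iN ->]; move: iN; rewrite mem_iota add0n /= => iN.
  rewrite /arc_start_ok leq_pmull ?expn_gt0 //=.
  by apply: leq_trans (Tend i iN); rewrite mulSn addnC.
have F0 x : 0 <= F x by have /andP[] := F01 x.
have [ys [x [sz mem pos]]] := box_form_gt0 F0 (hj Tok).
rewrite !size_map size_iota in sz mem.
have /choice[t tP] : forall i, exists t v : nat, (i < n)%N ->
   [/\ (4 ^ i.+1 * (k ^ 5 * b) <= t < (4 ^ i.+1).+1 * (k ^ 5 * b))%N,
       `|v%:R - circle_height L t%:R| <= k%:R,
       (v <= 2 * (k ^ 7 * b) + k * b)%N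
       & nth 0 ys i = torus_point p t%:Z v%:Z].
  move=> i; case: (ltnP i n) => iN; last by exists 0%N, 0%N.
  have := mem i iN; rewrite (nth_map 0%N) ?size_map ?size_iota // (nth_map 0%N) ?size_iota //.
  rewrite nth_iota // add0n => /allpairsP[[a w] [/= aK wk ->]].
  rewrite !mem_iota !add0n /= in aK wk.
  set T := (4 ^ i.+1 * _ + a)%N.
  have g0 := lattice_height_ge0 L T%:Z.
  have /andP[g1 g2] := lattice_height_itv L T%:Z.
  have L0 : 0 <= L by have /andP[L1 _] := Lk; apply: le_trans L1; rewrite ler0n.
  have gL := lattice_height_le T%:Z L0.
  set g := lattice_height _ _ in g0 g1 g2 gL *.
  have gN : (absz g)%:Z = g by exact: gez0_abs.
  rewrite -gN -!pmulrn in g1 g2 gL.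
  exists T, (absz g + w)%N => _; split.
  - by rewrite /T leq_addr /= mulSn addnC ltn_add2r.
  - have wR : w%:R <= k%:R - 1 :> R by rewrite lerBrDr natr1 ler_nat.
    have w0 : 0 <= w%:R :> R by rewrite ler0n.
    by rewrite natrD ler_norml; apply/andP; split; lra.
  - apply: leq_add; last by apply: leq_trans (ltnW wk) _; rewrite leq_pmulr.
    by rewrite -(ler_nat R) natrM; apply: le_trans gL _; have /andP[] := Lk.
  - by rewrite PoszD gN.
have /choice[v vP] : forall i, exists v : nat, (i < n)%N -> _ := tP.
exists x.1, x.2, t, v; split.
- by move=> i /vP[/andP[-> /ltnW ->]].
- by move=> i /vP[].
move=> r; have Fpos := cube_prod_gt0 F0 pos.
have sumE (q : nat -> bool) : x + \sum_(i < size ys) nth 0 ys i *+ q i =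
   torus_point p (x.1 + \sum_(i < n) t i * q i)%:Z (x.2 + \sum_(i < n) v i * q i)%:Z.
  rewrite -torus_point_sum torus_pointK sz; congr (_ + _).
  by apply: eq_bigr => i _; have [_ _ _ ->] := vP i (ltn_ord i).
(* The empty choice of edges puts the base point itself in [S], hence below [Q]. *)
have Sx : S x.1 x.2.
  have := Fpos (fun=> false); rewrite big1 => [|i _]; last by rewrite mulr0n.
  by rewrite addr0 /F; case: (S _ _); rewrite // ltxx.
have /andP[x1 x2] := SQ _ _ Sx.
have QE : Q = (k ^ 8 * (k ^ (8 * j) * b))%N.
  by rewrite /Q /b !mulnA -!expnD; congr (k ^ _ * _)%N; move: jJ; clear; lia.
have vQ : (\sum_(i < n) v i * r i <= Q)%N.
  apply: (sum_bound (c := 2 * (k ^ 7 * b) + k * b)) => [i /vP[] //|].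
  by rewrite QE; apply: height_bound; rewrite ?kp.
have tQ : (\sum_(i < n) t i * r i <= Q)%N.
  apply: (sum_bound (c := 2 * (k ^ 7 * b) + k * b)) => [i iN|].
    have [/andP[_ /ltnW h] _ _ _] := vP i iN.
    apply: leq_trans h _; apply: leq_trans (Tend i iN) _.
    apply: leq_trans (_ : k ^ 7 * b <= _)%N; first by rewrite leq_mul2r leq_pexp2l ?orbT.
    by rewrite mulSn mul1n -addnA leq_addr.
  by rewrite QE; apply: height_bound; rewrite ?kp.
have lt2Q c d : (c < Q -> d <= Q -> c + d < p.+2)%N.
  by move=> cQ dQ; rewrite pE mul2n -addnn -addSn leq_add.
have := Fpos r; rewrite sumE /F /torus_point /= !torus_nat; last first.
- exact: lt2Q.
- exact: lt2Q.
by case: (S _ _); rewrite // ltxx.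
Qed.

End discrete.

(** * Closed subsets of a plane set of positive measure *)

Local Open Scope classical_set_scope.
Local Open Scope ring_scope.

Section regularity.
Context {R : realType}.
Notation plane := (measurableTypeR R * measurableTypeR R)%type.
Variable nu : {measure set plane -> \bar R}.
Hypothesis nu_fin : (nu setT < +oo)%E.

(** Asking for the closed and the open approximation together makes the class stable under
    complement. *)
Definition regular_set (B : set (R * R)) : Prop :=
  forall e : R, 0 < e -> exists U F : set (R * R),
    [/\ open U /\ measurable (U : set plane), closed F /\ measurable (F : set plane),
        F `<=` B, B `<=` U & (nu (U `\` F) <= e%:E)%E].

Let nu_lt (X : set (R * R)) : measurable (X : set plane) -> (nu X < +oo)%E.
Proof.
move=> mX; apply: le_lt_trans nu_fin.
by apply: le_measure; rewrite ?inE.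
Qed.

Let eventually_small (E : (set (R * R))^nat) (e : R) : 0 < e ->
  (forall n, measurable (E n : set plane)) ->
  (forall m n, (m <= n)%N -> E n `<=` E m) ->
  (nu (\bigcap_n E n) <= (e / 2)%:E)%E ->
  exists n, (nu (E n) <= e%:E)%E.
Proof.
move=> e0 mE dec small.
have cv : (nu \o E) @ \oo --> nu (\bigcap_n E n).
  apply: nonincreasing_cvg_mu => //; first exact/nu_lt.
    exact: bigcap_measurable.
  by move=> m n mn; apply/subsetPset/dec.
apply: contrapT => /forallNP nn.
have : (e%:E <= nu (\bigcap_n E n))%E.
  apply: cvge_ge cv; apply: nearW => n /=.
  by rewrite leNgt; apply/negP => /ltW; exact: nn.
move=> /le_trans /(_ small); rewrite lee_fin leNgt => /negP; apply.
by rewrite ltr_pdivrMr // ltr_pMr // ltr1n.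
Qed.

Lemma regular_setC B : regular_set B -> regular_set (~` B).
Proof.
move=> rB e e0; have [U [F [[oU mU] [cF mF] FB BU UF]]] := rB e e0.
exists (~` F), (~` U); split.
- by split; [rewrite openC|exact: measurableC].
- by split; [rewrite closedC|exact: measurableC].
- exact: subsetC.
- exact: subsetC.
- by rewrite setDE setCK setIC -setDE.
Qed.

(** The open sets are joined with summable errors. A countable union of closed sets need not be
    closed, but finitely many of them suffice, by continuity from above of the finite measure
    [nu]. *)
Lemma regular_set_bigcup (B : (set (R * R))^nat) :
  (forall n, regular_set (B n)) -> regular_set (\bigcup_n B n).
Proof.
move=> rB e e0.
have e2 : 0 < e / 2 by rewrite divr_gt0.
have en n : 0 < e / 2 / (2 ^ n.+1)%:R by rewrite divr_gt0 // ltr0n expn_gt0.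
have /choice[U UP] : forall n, exists U, exists F : set (R * R),
    [/\ open U /\ measurable (U : set plane), closed F /\ measurable (F : set plane),
        F `<=` B n, B n `<=` U & (nu (U `\` F) <= (e / 2 / (2 ^ n.+1)%:R)%:E)%E].
  by move=> n; exact: rB n _ (en n).
have /choice[F FP] := UP.
pose UU := \bigcup_n U n; pose FF n := \big[setU/set0]_(i < n) F i.
have mU n : measurable (U n : set plane) by have [[]] := FP n.
have mF n : measurable (F n : set plane) by have [_ []] := FP n.
have mUU : measurable (UU : set plane) by exact: bigcup_measurable.
have mFF n : measurable (FF n : set plane) by exact: bigsetU_measurable.
have mFo : measurable (\bigcup_n F n : set plane) by exact: bigcup_measurable.
have small : (nu (UU `\` \bigcup_n F n) <= (e / 2)%:E)%E.
  apply: (@le_trans _ _ (\sum_(0 <= n <oo) nu (U n `\` F n)))%E.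
    apply: measure_sigma_subadditive => [n||x [[n _ Un] nF]].
    - exact: measurableD.
    - exact: measurableD.
    - by exists n => //; split=> // Fn; apply: nF; exists n.
  apply: (@le_trans _ _ (\sum_(0 <= n <oo) (0 + (e / 2 / (2 ^ n.+1)%:R)%:E)))%E.
    by apply: lee_nneseries => // n _; rewrite add0e; have [] := FP n.
  apply: le_trans (epsilon_trick xpredT (fun=> lexx _) (ltW e2)) _.
  by rewrite eseries0 // add0e.
have capE : \bigcap_n (UU `\` FF n) = UU `\` \bigcup_n F n.
  rewrite setDE setC_bigcup -bigcapIr; last by exists 0%N.
  apply/seteqP; split=> x h.
    move=> n _; have [Ux _] := h n I; split=> // Fx.
    have [_] := h n.+1 I; apply; rewrite /FF big_ord_recr; by right.
  move=> n _; have [Ux _] := h n I; split=> //.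
  rewrite /FF -bigcup_mkord => -[i _ Fi]; by have [_] := h i I; apply.
have [n hn] : exists n, (nu (UU `\` FF n) <= e%:E)%E.
  apply: eventually_small => //.
  - by move=> n; exact: measurableD.
  - move=> m n mn; apply: setDS; rewrite /FF -!bigcup_mkord => x [i im Fi].
    by exists i => //; exact: leq_trans im mn.
  - by rewrite capE.
exists UU, (FF n); split => //.
- by split => //; apply: bigcup_open => i _; have [[]] := FP i.
- split => //; apply: closed_bigsetU => i _; by have [_ []] := FP i.
- rewrite /FF -bigcup_mkord => x [i _ Fi]; exists i => //.
  by have [_ _ + _ _] := FP i; apply.
- by move=> x [i _ Bi]; exists i => //; have [_ _ _ + _] := FP i; apply.
Qed.

Lemma regular_set0 : regular_set set0.
Proof.
move=> e e0; exists set0, set0; split => //.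
- by split; [exact: open0|].
- by split; [exact: closed0|].
- by rewrite setDv measure0 lee_fin ltW.
Qed.

Lemma sigma_algebra_regular : sigma_algebra setT regular_set.
Proof.
split; [exact: regular_set0| |exact: regular_set_bigcup].
by move=> A rA; rewrite setTD; exact: regular_setC.
Qed.

Lemma regular_setI A B : regular_set A -> regular_set B -> regular_set (A `&` B).
Proof.
move=> rA rB; rewrite -[A `&` B]setCK setCI; apply: regular_setC.
rewrite -bigcup2E; apply: regular_set_bigcup => -[|[|n]] /=.
- exact: regular_setC.
- exact: regular_setC.
- exact: regular_set0.
Qed.

(** Borel sets of the line are generated by the open half-lines, which are exhausted by closed
    ones. *)
Lemma regular_preimage (f : R * R -> R) : continuous f ->
  measurable_fun setT (f : plane -> measurableTypeR R) ->
  forall A : set R, measurable (A : set (measurableTypeR R)) -> regular_set (f @^-1` A).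
Proof.
move=> cf mf A mA.
have sa : sigma_algebra setT [set A : set R | regular_set (f @^-1` A)].
  split => /=.
  - by rewrite preimage_set0; exact: regular_set0.
  - by move=> X rX; rewrite setTD preimage_setC; exact: regular_setC.
  - by move=> X rX; rewrite preimage_bigcup; exact: regular_set_bigcup.
suff sub : (@measurable_realfun.RGenOInfty.G R).-sigma.-measurable `<=`
    [set A : set R | regular_set (f @^-1` A)].
  by apply: sub; rewrite -measurable_realfun.RGenOInfty.measurableE.
apply: smallest_sub => // _ [x ->] /=.
have mfray (y : R) (b : bool) : measurable ((f @^-1` [set` Interval (BSide b y) +oo%O]) : set plane).
  by rewrite -[X in measurable X]setTI; apply: mf => //; exact: measurable_itv.
move=> e e0; pose F n := f @^-1` `[x + n.+1%:R^-1, +oo[.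
have FU n : F n `<=` f @^-1` `]x, +oo[.
  move=> z; rewrite /F /= !in_itv /= !andbT; apply: lt_le_trans.
  by rewrite ltrDl invr_gt0.
have [n hn] : exists n, (nu (f @^-1` `]x, +oo[ `\` F n) <= e%:E)%E.
  apply: eventually_small => //.
  - by move=> n; apply: measurableD; exact: mfray.
  - move=> m n mn; apply: setDS => z; rewrite /F /= !in_itv /= !andbT; apply: le_trans.
    by rewrite lerD2l lef_pV2 ?posrE // ler_nat.
  - rewrite (_ : \bigcap_n _ = set0) ?measure0 ?lee_fin ?divr_ge0 ?ltW //.
    apply/seteqP; split=> z //= h.
    have [+ _] := h 0%N I; rewrite /= in_itv /= andbT => xz.
    have xz' : 0 < f z - x by rewrite subr_gt0.
    have [N _ /(_ N (leqnn N)) /= hN] := near_infty_natSinv_lt (PosNum xz').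
    have [_] := h N I; apply; rewrite /F /= in_itv /= andbT.
    by rewrite addrC -lerBrDr ltW.
exists (f @^-1` `]x, +oo[), (F n); split => //.
- split; last exact: mfray.
  by apply: open_comp; [move=> z _; exact: cf|exact: rray_open].
- split; last exact: mfray.
  by apply: preimage_closed; [move=> z _; exact: cf|exact: rray_closed].
Qed.

Lemma regular_measurable (B : set (R * R)) : measurable (B : set plane) -> regular_set B.
Proof.
rewrite [X in X B -> _](measurable_prod_measurableType (measurableTypeR R) (measurableTypeR R)).
apply: smallest_sub; first exact: sigma_algebra_regular.
move=> _ [A1 mA1 [A2 mA2 <-]].
have -> : A1 `*` A2 = (fst @^-1` A1) `&` (snd @^-1` A2) by [].
apply: regular_setI; apply: regular_preimage => //.
- by move=> z; exact: cvg_fst.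
- by move=> z; exact: cvg_snd.
Qed.

End regularity.

Section closed_subset.
Context {R : realType}.
Notation plane := (measurableTypeR R * measurableTypeR R)%type.
Notation mu2 := (@lebesgue_measure R \x @lebesgue_measure R)%E.

Definition rectangle (a b c d : R) : set (R * R) := `[a, b] `*` `[c, d].

Lemma measurable_rectangle a b c d : measurable (rectangle a b c d : set plane).
Proof. by apply: measurableX; exact: measurable_itv. Qed.

Lemma closed_rectangle a b c d : closed (rectangle a b c d).
Proof.
have -> : rectangle a b c d = (fst @^-1` `[a, b]) `&` (snd @^-1` `[c, d]) by [].
apply: closedI; apply: preimage_closed; try exact: interval_closed.
- by move=> z _; exact: cvg_fst.
- by move=> z _; exact: cvg_snd.
Qed.

Lemma lebesgue_rectangle (a b c d : R) : a <= b -> c <= d ->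
  mu2 (rectangle a b c d) = ((b - a) * (d - c))%:E.
Proof.
move=> ab cd; rewrite product_measure1E; [|exact: measurable_itv|exact: measurable_itv].
have E (x y : R) : x <= y -> @lebesgue_measure R `[x, y] = (y - x)%:E.
  move=> xy; rewrite lebesgue_measure_itv /= lte_fin.
  by case: ltgtP xy => // -> _; rewrite subrr.
by rewrite EFinM -(E _ _ ab) -(E _ _ cd).
Qed.

(** As [A] is only Caratheodory measurable, the complement is approximated: Borel sets cover it
    within [delta / 4], an open [U] contains their union within another [delta / 4], and the square
    minus [U] lies in [A]. *)
Lemma closed_subset_lebesgue (A : set (R * R)) (delta : R) : 0 < delta ->
  lebesgue_measurable2 A -> A `<=` rectangle 0 1 0 1 ->
  (delta%:E <= lebesgue_measure2 A)%E ->
  exists K : set (R * R), [/\ closed K, measurable (K : set plane), K `<=` A &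
    ((delta / 2)%:E <= mu2 K)%E].
Proof.
move=> d0 mA A1 dA; set I2 := rectangle 0 1 0 1.
have mI2 : measurable (I2 : set plane) by exact: measurable_rectangle.
have muI2 : mu2 I2 = 1%:E by rewrite lebesgue_rectangle // !subr0 mulr1.
pose mue := (mu2^*)%mu.
have mueI : mue I2 = 1%:E by rewrite /mue measurable_mu_extE.
have split1 : (mue I2 = mue (I2 `&` A) + mue (I2 `&` ~` A))%E by exact: mA.
have IA : I2 `&` A = A by apply/setIidPr.
rewrite IA mueI in split1.
have muA0 : (0 <= mue A)%E by exact: mu_ext_ge0.
have muB0 : (0 <= mue (I2 `&` ~` A))%E by exact: mu_ext_ge0.
have fB : mue (I2 `&` ~` A) \is a fin_num.
  rewrite ge0_fin_numE //; apply: (@le_lt_trans _ _ 1%:E); last by rewrite ltry.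
  by rewrite split1 leeDr.
have fA : mue A \is a fin_num.
  rewrite ge0_fin_numE //; apply: (@le_lt_trans _ _ 1%:E); last by rewrite ltry.
  by rewrite split1 leeDl.
have d4 : 0 < delta / 4 by rewrite divr_gt0.
have [_ [B [mB IB] <-] Bsum] := lb_ereal_inf_adherent d4 fB.
pose BB := \bigcup_k B k.
have mBB : measurable (BB : set plane) by exact: bigcup_measurable.
have muBB : (mu2 BB <= mue (I2 `&` ~` A) + (delta / 4)%:E)%E.
  apply: le_trans (ltW Bsum); exact: generalized_Boole_inequality.
(* Restriction to the unit square gives the finite measure that regularity requires. *)
pose nu : {measure set plane -> \bar R} := mrestr mu2 mI2.
have nuT : (nu setT < +oo)%E by rewrite /nu /= /mrestr setTI muI2 ltry.
have [U [F [[oU mU] [cF mF] FB BU UF]]] := regular_measurable nuT mBB d4.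
exists (I2 `\` U); split.
- by rewrite setDE; apply: closedI; [exact: closed_rectangle|rewrite closedC].
- exact: measurableD.
- move=> x [Ix Ux]; apply: contrapT => nA; apply: Ux; apply: BU; exact: IB.
have nuU : (mu2 (I2 `&` U) <= mu2 BB + (delta / 4)%:E)%E.
  have UE : I2 `&` U `<=` BB `|` ((U `\` F) `&` I2).
    move=> x [Ix Ux]; have [Fx|nFx] := pselect (F x); first by left; exact: FB.
    by right.
  have mUF : measurable (((U `\` F) `&` I2) : set plane).
    by apply: measurableI => //; exact: measurableD.
  apply: (@le_trans _ _ (mu2 (BB `|` ((U `\` F) `&` I2)))).
    by apply: le_measure; rewrite ?inE //; [exact: measurableI|exact: measurableU].
  apply: le_trans (measureU2 _ mBB mUF) _; exact: leeD2l.
have fU : mu2 (I2 `&` U) \is a fin_num.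
  rewrite ge0_fin_numE //; apply: (@le_lt_trans _ _ (mu2 I2)); last by rewrite muI2 ltry.
  by apply: le_measure; rewrite ?inE //; exact: measurableI.
have KE : (mu2 I2 = mu2 (I2 `\` U) + mu2 (I2 `&` U))%E.
  rewrite -measureU //; first by rewrite setUC setUIDK.
  - exact: measurableD.
  - exact: measurableI.
  - by apply/seteqP; split=> x // [[_ nU] [_ Ux]].
have fK : mu2 (I2 `\` U) \is a fin_num.
  rewrite ge0_fin_numE //; apply: (@le_lt_trans _ _ (mu2 I2)); last by rewrite muI2 ltry.
  by rewrite KE leeDl.
have dA' : (delta%:E <= mue A)%E by exact: dA.
have fBB : mu2 BB \is a fin_num.
  rewrite ge0_fin_numE //; apply: le_lt_trans muBB _.
  by rewrite -(fineK fB) -EFinD ltry.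
move: dA' split1 muBB nuU KE; rewrite muI2.
rewrite -(fineK fA) -(fineK fB) -(fineK fU) -(fineK fK) -(fineK fBB) -!EFinD !lee_fin.
by move=> h1 [h2] h3 h4 [h5]; lra.
Qed.

End closed_subset.

(** * Discretization by lattice cells *)

Section cells.
Context {R : realType}.
Notation plane := (measurableTypeR R * measurableTypeR R)%type.
Notation mu2 := (@lebesgue_measure R \x @lebesgue_measure R)%E.

Definition cell (Q i j : nat) : set (R * R) :=
  rectangle (i%:R / Q%:R) (i.+1%:R / Q%:R) (j%:R / Q%:R) (j.+1%:R / Q%:R).

Definition meets_cell (K : set (R * R)) (Q i j : nat) : bool :=
  [&& (i < Q)%N, (j < Q)%N & `[< K `&` cell Q i j !=set0 >]].

Let cell_index (Q : nat) (x : R) : (0 < Q)%N -> 0 <= x <= 1 ->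
  exists2 i, (i < Q)%N & i%:R / Q%:R <= x <= i.+1%:R / Q%:R.
Proof.
move=> Q0 /andP[x0 x1]; have QR : 0 < Q%:R :> R by rewrite ltr0n.
have xQ0 : 0 <= x * Q%:R by rewrite mulr_ge0.
have [x1'|] := ltP x 1; last first.
  (* The endpoint 1 belongs to the last closed cell, where truncation would return [Q]. *)
  move=> x1''; exists Q.-1; first by rewrite ltn_predL.
  rewrite prednK // divff ?gt_eqF // x1 andbT ler_pdivrMr //.
  apply: (@le_trans _ _ Q%:R); first by rewrite ler_nat leq_pred.
  by rewrite ler_peMl // ltW.
exists (Num.truncn (x * Q%:R)).
  rewrite -(ltr_nat R); apply: (@le_lt_trans _ _ (x * Q%:R)); first by rewrite truncn_le.
  by rewrite gtr_pMl.
rewrite ler_pdivrMr // ler_pdivlMr // truncn_le xQ0 /=; exact/ltW/truncnS_gt.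
Qed.

(** The range [N] is left free so that the count can run over a torus of side [2 * Q]. *)
Lemma lebesgue_le_cells (K : set (R * R)) (Q N : nat) :
  (0 < Q)%N -> (Q <= N)%N -> measurable (K : set plane) -> K `<=` rectangle 0 1 0 1 ->
  (mu2 K <= ((\sum_(i < N) \sum_(j < N) (meets_cell K Q i j)%:R) / Q%:R ^+ 2)%:E)%E.
Proof.
move=> Q0 QN mK K1; have QR : 0 < Q%:R :> R by rewrite ltr0n.
pose X (i j : nat) : set (R * R) := if meets_cell K Q i j then cell Q i j else set0.
have mX i j : measurable (X i j : set plane).
  by rewrite /X; case: ifP => _; [exact: measurable_rectangle|exact: measurable0].
have muX i j : (mu2 (X i j) <= ((meets_cell K Q i j)%:R / Q%:R ^+ 2)%:E)%E.
  rewrite /X; case: ifP => _; last by rewrite measure0 mul0r.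
  have d (m : nat) : m%:R / Q%:R <= m.+1%:R / Q%:R :> R.
    by rewrite ler_pM2r ?invr_gt0 // ler_nat.
  have w (m : nat) : m.+1%:R / Q%:R - m%:R / Q%:R = Q%:R^-1 :> R.
    by rewrite -mulrBl -natr1 addrAC subrr add0r mul1r.
  by rewrite (lebesgue_rectangle (d i) (d j)) lee_fin !w mul1r expr2 invfM.
pose Y (i : nat) : set (R * R) := \big[setU/set0]_(j < N) X i j.
have mY i : measurable (Y i : set plane) by exact: bigsetU_measurable.
have KY : K `<=` \big[setU/set0]_(i < N) Y i.
  move=> p Kp; have [/= p1 p2] := K1 p Kp.
  have [i iQ hi] := cell_index Q0 p1; have [j jQ hj] := cell_index Q0 p2.
  have cp : cell Q i j p by apply: conj; rewrite /= in_itv.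
  have m : meets_cell K Q i j.
    by rewrite /meets_cell iQ jQ /=; apply/asboolP; exists p.
  rewrite -bigcup_mkord; exists i; first exact: leq_trans iQ QN.
  rewrite /Y -bigcup_mkord; exists j; first exact: leq_trans jQ QN.
  by rewrite /X m.
apply: (@le_trans _ _ (mu2 (\big[setU/set0]_(i < N) Y i))).
  by apply: le_measure; rewrite ?inE //; exact: bigsetU_measurable.
apply: le_trans (Boole_inequality _ _) _ => //.
rewrite mulr_suml -sumEFin; apply: lee_sum => i _.
apply: le_trans (Boole_inequality _ _) _ => //.
by rewrite mulr_suml -sumEFin; apply: lee_sum => j _; exact: muX.
Qed.

End cells.

(** * Limits of discrete configurations *)

Section limits.
Context {R : realType}.

Lemma ultra_bounded_cvg (T : Type) (U : set_system T) (f : T -> R) : UltraFilter U ->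
  U [set x | 0 <= f x <= 1] -> exists l : R, f @ U --> l.
Proof.
move=> UU Uf.
have UfU : UltraFilter (f @ U).
  split; first exact: fmap_proper_filter.
  move=> G PG UG; apply/seteqP; split=> A GA; last exact: UG.
  have [//|UnA] := in_ultra_setVsetC (f @^-1` A) UU.
  have GnA : G (~` A) by apply: UG.
  by have [z []] := filter_ex (filterI GA GnA).
have := @segment_compact R 0 1; rewrite compact_ultra => /(_ _ UfU) [|l [_ fl]].
  by apply: (@filterS _ U _ [set x | 0 <= f x <= 1]) Uf => x; rewrite /= in_itv.
by exists l.
Qed.

(* The [i]-th abscissa exceeds the sum of all the previous ones. *)
Lemma lacunary_sum_inj (n : nat) (tau : R) (T : nat -> R) (r s : nat -> bool) : 0 < tau ->
  (forall i, (i < n)%N -> (4 ^ i.+1)%:R * tau <= T i <= (4 ^ i.+1).+1%:R * tau) ->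
  \sum_(i < n) T i *+ r i = \sum_(i < n) T i *+ s i ->
  forall i, (i < n)%N -> r i = s i.
Proof.
move=> tau0; elim: n => [//|n IH] Tb.
have Tb' i : (i < n)%N -> (4 ^ i.+1)%:R * tau <= T i <= (4 ^ i.+1).+1%:R * tau.
  by move=> iN; apply: Tb; exact: ltnW.
have T0 i : (i < n.+1)%N -> 0 <= T i.
  by move=> /Tb /andP[h _]; apply: le_trans h; rewrite mulr_ge0 // ltW.
have small m (q : nat -> bool) : (m <= n.+1)%N -> \sum_(i < m) T i *+ q i < (4 ^ m.+1)%:R * tau.
  elim: m => [|m IHm] mn; first by rewrite big_ord0 mulr_gt0.
  rewrite big_ord_recr /=; have h := IHm (ltnW mn).
  have /andP[_ h2] := Tb m mn.
  have h3 : T m *+ q m <= (4 ^ m.+1).+1%:R * tau.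
    by apply: le_trans h2; case: (q m); rewrite ?mulr1n // mulr0n T0.
  have h4 : (4 ^ m.+1)%:R * tau + (4 ^ m.+1).+1%:R * tau <= (4 ^ m.+2)%:R * tau.
    rewrite -mulrDl ler_pM2r // -natrD ler_nat [leqRHS]expnS.
    have : (0 < 4 ^ m.+1)%N by rewrite expn_gt0.
    lia.
  by apply: lt_le_trans h4; exact: ltr_leD.
rewrite !big_ord_recr /= => e.
have e' : r n = s n.
  have /andP[hn _] := Tb n (ltnSn n).
  have pos q : 0 <= \sum_(i < n) T i *+ q i.
    by apply: sumr_ge0 => i _; rewrite mulrn_wge0 // T0 // ltnS ltnW.
  have := small n r (leqnSn n); have := small n s (leqnSn n).
  have := pos r; have := pos s.
  by move: e; case: (r n); case: (s n) => //; rewrite !mulr0n !mulr1n; lra.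
move: e; rewrite e' => /addIr /(IH Tb') h i; rewrite ltnS leq_eqVlt => /orP[/eqP -> //|]; exact: h.
Qed.

Lemma circle_height_homogeneous (L q t : R) : 0 <= q ->
  circle_height (L * q) (t * q) = circle_height L t * q.
Proof.
move=> q0; rewrite /circle_height !exprMn -mulrBl mulrC sqrtrM ?sqr_ge0 //.
by rewrite sqrtr_sqr ger0_norm // mulrC.
Qed.

Lemma continuous_circle_height (L : R) : continuous (circle_height L).
Proof.
move=> t; apply: continuous_comp; last exact: sqrt_continuous.
by apply: cvgB; [exact: cvg_cst|exact: exprn_continuous].
Qed.

(** Along an ultrafilter all the rescaled coordinates converge at once, without extracting
    subsequences. The height error [k] is divided by [Q m], so it vanishes and the limit edges lie
    exactly on the circle. *)
Lemma limit_hypercube (K : set (R * R)) (n : nat) (U : set_system nat) (Q : nat -> nat)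
    (lambda tau k : R) :
  closed K -> UltraFilter U -> (fun m => (Q m)%:R^-1 : R) @ U --> (0 : R) ->
  (forall m, 0 < Q m)%N -> 0 < lambda -> 0 < tau ->
  (4 ^ n).+1%:R * tau <= lambda ->
  U [set m | exists x y : nat, exists t v : nat -> nat,
    [/\ forall i, (i < n)%N ->
          (4 ^ i.+1)%:R * tau <= (t i)%:R / (Q m)%:R <= (4 ^ i.+1).+1%:R * tau,
        forall i, (i < n)%N -> `|(v i)%:R - circle_height (lambda * (Q m)%:R) (t i)%:R| <= k
      & forall r : nat -> bool,
          meets_cell K (Q m) (x + \sum_(i < n) t i * r i) (y + \sum_(i < n) v i * r i)]] ->
  contains_hypercube_graph n lambda K.
Proof.
move=> cK UU Q0 Qpos l0 tau0 ltau; set W := [set m | _] => UW.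
have /choice[x /choice[y /choice[t /choice[v H]]]] : forall m, exists x y : nat,
  exists t v : nat -> nat, W m ->
    [/\ forall i, (i < n)%N ->
          (4 ^ i.+1)%:R * tau <= (t i)%:R / (Q m)%:R <= (4 ^ i.+1).+1%:R * tau,
        forall i, (i < n)%N -> `|(v i)%:R - circle_height (lambda * (Q m)%:R) (t i)%:R| <= k
      & forall r : nat -> bool,
          meets_cell K (Q m) (x + \sum_(i < n) t i * r i) (y + \sum_(i < n) v i * r i)].
  move=> m; have [[x [y [t [v h]]]]|nW] := pselect (W m).
    by exists x, y, t, v.
  by exists 0%N, 0%N, id, id.
pose sc (a : nat -> nat) m : R := (a m)%:R / (Q m)%:R.
have QR m : 0 < (Q m)%:R :> R by rewrite ltr0n.
have sc01 (a : nat -> nat) : (forall m, W m -> (a m < Q m)%N) -> U [set m | 0 <= sc a m <= 1].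
  move=> aQ; apply: filterS UW => m Wm /=.
  by rewrite /sc divr_ge0 //= ler_pdivrMr // mul1r ler_nat ltnW // aQ.
have lim (a : nat -> nat) : (forall m, W m -> (a m < Q m)%N) -> exists l : R, sc a @ U --> l.
  by move=> aQ; apply: ultra_bounded_cvg; exact: sc01.
have bound m : W m -> (x m + \sum_(i < n) t m i < Q m)%N /\ (y m + \sum_(i < n) v m i < Q m)%N.
  move=> Wm; have [_ _ /(_ (fun=> true)) /and3P[h1 h2 _]] := H m Wm.
  move: h1 h2; under eq_bigr do rewrite muln1.
  by under [in X in _ -> X -> _]eq_bigr do rewrite muln1.
have term (a : nat -> nat) i : (i < n)%N -> (a i <= \sum_(i < n) a i)%N.
  by move=> iN; rewrite (bigD1 (Ordinal iN)) //= leq_addr.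
have [X cX] : exists l : R, sc x @ U --> l.
  by apply: lim => m /bound[h _]; apply: leq_ltn_trans h; exact: leq_addr.
have [Y cY] : exists l : R, sc y @ U --> l.
  by apply: lim => m /bound[_ h]; apply: leq_ltn_trans h; exact: leq_addr.
have /choice[T cT] : forall i, exists l : R, (i < n)%N -> sc (fun m => t m i) @ U --> l.
  move=> i; have [iN|_] := ltnP i n; last by exists 0.
  have [|l cl] := lim (fun m => t m i); last by exists l.
  move=> m /bound[h _]; apply: leq_ltn_trans h.
  by apply: (leq_trans (term (t m) i iN)); exact: leq_addl.
have /choice[V cV] : forall i, exists l : R, (i < n)%N -> sc (fun m => v m i) @ U --> l.
  move=> i; have [iN|_] := ltnP i n; last by exists 0.
  have [|l cl] := lim (fun m => v m i); last by exists l.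
  move=> m /bound[_ h]; apply: leq_ltn_trans h.
  by apply: (leq_trans (term (v m) i iN)); exact: leq_addl.
have Tb i : (i < n)%N -> (4 ^ i.+1)%:R * tau <= T i <= (4 ^ i.+1).+1%:R * tau.
  move=> iN; suff : [set` `[(4 ^ i.+1)%:R * tau, (4 ^ i.+1).+1%:R * tau] ] (T i).
    by rewrite /= in_itv.
  apply: closed_cvg (cT i iN); first exact: interval_closed.
  by apply: filterS UW => m /H[h _ _] /=; rewrite in_itv; exact: h.
have VT i : (i < n)%N -> V i = circle_height lambda (T i).
  move=> iN; apply/eqP; rewrite -subr_eq0 -normr_le0.
  have c1 : (fun m => `|sc (fun m => v m i) m - circle_height lambda (sc (fun m => t m i) m)|) @ U
      --> `|V i - circle_height lambda (T i)|.
    apply: cvg_norm; apply: cvgB; first exact: cV.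
    by apply: continuous_cvg; [exact: continuous_circle_height|exact: cT].
  have c2 : (fun m => k * (Q m)%:R^-1) @ U --> k * 0 by apply: cvgMl_tmp.
  rewrite mulr0 in c2.
  apply: ler_cvg_to c1 c2 _; apply: filterS UW => m /H[_ h _].
  rewrite -(ler_pM2r (QR m)) divfK ?gt_eqF // -[X in _ * X <= _](ger0_norm (ltW (QR m))) -normrM mulrBl.
  rewrite -circle_height_homogeneous; last exact: ltW.
  by rewrite /sc !divfK ?gt_eqF //; exact: h.
(* Beyond [lambda] the square root in [circle_height] is 0 by convention, and the edge would be too
   long. *)
have Tl i : (i < n)%N -> 0 <= T i <= lambda.
  move=> iN; have /andP[h1 h2] := Tb i iN; apply/andP; split.
    by apply: le_trans h1; rewrite mulr_ge0 // ltW.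
  apply: le_trans h2 (le_trans _ ltau); rewrite ler_pM2r // ler_nat ltnS.
  by rewrite leq_exp2l.
have vertex (r : nat -> bool) : K (X + \sum_(i < n) T i *+ r i, Y + \sum_(i < n) V i *+ r i).
  have cell_lim (z : nat -> nat) (a : nat -> nat -> nat) (Z : R) (B : nat -> R) :
      sc z @ U --> Z -> (forall i, (i < n)%N -> sc (fun m => a m i) @ U --> B i) ->
      (fun m => (z m + \sum_(i < n) a m i * r i)%:R / (Q m)%:R) @ U
        --> Z + \sum_(i < n) B i *+ r i.
    move=> cZ cB.
    have -> : (fun m => (z m + \sum_(i < n) a m i * r i)%:R / (Q m)%:R) =
       (fun m => sc z m + \sum_(i < n) sc (fun m => a m i) m * (r i)%:R).
      apply/funext => m; rewrite natrD mulrDl natr_sum mulr_suml; congr (_ + _).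
      by apply: eq_bigr => i _; rewrite natrM mulrAC.
    apply: cvgD => //; under eq_bigr do rewrite -mulr_natr.
    apply: cvg_big => [|i _]; first exact: add_continuous.
    by apply: cvgM; [exact: cB|exact: cvg_cst].
  (* A point of [K] is picked in each cell; as the cells shrink, it converges with their corners. *)
  have /choice[p hp] : forall m, exists p : R * R, W m -> K p /\
     cell (Q m) (x m + \sum_(i < n) t m i * r i) (y m + \sum_(i < n) v m i * r i) p.
    move=> m; have [Wm|nW] := pselect (W m); last by exists (0, 0).
    have [_ _ /(_ r) /and3P[_ _ /asboolP[p [Kp cp]]]] := H m Wm.
    by exists p.
  have squeeze (f a : nat -> R) (l : R) :
      (forall m, W m -> a m / (Q m)%:R <= f m <= (a m + 1) / (Q m)%:R) ->
      (fun m => a m / (Q m)%:R) @ U --> l -> f @ U --> l.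
    move=> hf ca.
    have ca1 : (fun m => (a m + 1) / (Q m)%:R) @ U --> l.
      rewrite -[l]addr0 (_ : (fun m => _) = (fun m => a m / (Q m)%:R + (Q m)%:R^-1)).
        exact: cvgD.
      by apply/funext => m; rewrite mulrDl mul1r.
    by apply: squeeze_cvgr ca ca1; apply: filterS UW => m; exact: hf.
  have c1 : (fun m => (p m).1) @ U --> X + \sum_(i < n) T i *+ r i.
    apply: squeeze (cell_lim _ _ _ _ cX cT) => m /hp[_ [/= + _]].
    by rewrite in_itv -natr1.
  have c2 : (fun m => (p m).2) @ U --> Y + \sum_(i < n) V i *+ r i.
    apply: squeeze (cell_lim _ _ _ _ cY cV) => m /hp[_ [/= _]].
    by rewrite in_itv -natr1.
  have cp : (fun m => ((p m).1, (p m).2)) @ U -->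
      (X + \sum_(i < n) T i *+ r i, Y + \sum_(i < n) V i *+ r i) by exact: (cvg_pair c1 c2).
  refine (@closed_cvg _ _ _ _ _ K cK _ _ cp).
  by apply: filterS UW => m /hp[Kp _]; rewrite -surjective_pairing.
pose yy (i : 'I_n) : R * R := (T i, V i).
pose ext (r : {ffun 'I_n -> bool}) (i : nat) : bool :=
  if insub i is Some o then r o else false.
have extE r (i : 'I_n) : ext r i = r i by rewrite /ext valK.
have vE r : cube_vertex (X, Y) yy r =
    (X + \sum_(i < n) T i *+ ext r i, Y + \sum_(i < n) V i *+ ext r i).
  rewrite /cube_vertex.
  have -> : \sum_(i < n) yy i *+ r i =
     (\sum_(i < n) T i *+ ext r i, \sum_(i < n) V i *+ ext r i).
    under [X in (X, _)]eq_bigr do rewrite extE.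
    under [X in (_, X)]eq_bigr do rewrite extE.
    apply: (big_ind3 (fun (a : R * R) (b c : R) => a = (b, c))) => //.
      by move=> a1 a2 a3 b1 b2 b3 -> ->.
    by move=> i _; rewrite /yy; case: (r i).
  by [].
exists (X, Y), yy; split.
- move=> i; rewrite /euclidean_norm /yy /= (VT i (ltn_ord i)).
  have /andP[h1 h2] := Tl i (ltn_ord i).
  by rewrite circle_height_sqr // addrC subrK sqrtr_sqr ger0_norm // ltW.
- by move=> r; rewrite vE; exact: vertex.
(* Abscissae alone distinguish the vertices. *)
move=> r s; rewrite !vE => -[/addrI e _]; apply/ffunP => i.
by rewrite -!extE; exact: (lacunary_sum_inj tau0 Tb e (ltn_ord i)).
Qed.

End limits.

(** * Choice of the parameters *)

Section parameters.
Context {R : realType}.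
Variables (n d : nat).
Hypothesis d2 : (2 <= d)%N.

(** A set of density [d ^ (- 4)] has cubes of density at least [d ^ (- 4 * 2 ^ n)]. The margin
    [n + 2] absorbs the factor [n], at most [d ^ n], and the sum of three error terms, as
    [3 < d ^ 2]. *)
Definition err_exponent : nat := (n + 2 + 4 * 2 ^ n)%N.
(** The exponent makes [err ^+ 2 * ratio%:R] equal to [d ^ 8], at least 256 and so above 132. *)
Definition ratio : nat := (d ^ (2 * err_exponent + 8))%N.
(** [4 * ratio ^ 10] is at most [d ^ (20 * err_exponent + 82)], where 82 is ten times 8, plus 2 for
    the factor 4; the last summand leaves an error [d ^ (- err_exponent)]. *)
Definition scale_exponent : nat := ((20 * err_exponent + 82) * n + err_exponent)%N.
Definition scale_count : nat := (d ^ scale_exponent)%N.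
Definition err : R := (d%:R ^+ err_exponent)^-1.

Lemma ratio_ge : [/\ (8 <= ratio)%N, (4 ^ n.+1 <= ratio)%N & (3 * n <= ratio)%N].
Proof.
have le2 i : (i <= 2 * err_exponent + 8)%N -> (2 ^ i <= ratio)%N.
  move=> h; apply: (@leq_trans (d ^ i)%N); first by case: i h => // i _; rewrite leq_exp2r.
  by rewrite leq_pexp2l //; apply: leq_trans d2.
split.
- by apply: (le2 3%N); lia.
- have -> : (4 ^ n.+1 = 2 ^ (2 * n.+1))%N by rewrite expnM.
  by apply: le2; rewrite /err_exponent; lia.
apply: leq_trans (le2 (n + 2)%N _); last by rewrite /err_exponent; lia.
rewrite expnD mulnC; apply: leq_mul => //; exact: ltnW (ltn_expl _ _).
Qed.

Let D : R := d%:R.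
Let D2 : 2 <= D. Proof. by rewrite /D ler_nat. Qed.
Let D0 : 0 < D. Proof. by apply: lt_le_trans D2. Qed.
Let DX i : 0 < D ^+ i. Proof. exact: exprn_gt0. Qed.

Lemma err_gt0 : 0 < err.
Proof. by rewrite invr_gt0. Qed.

Let pow2_le i : (2 ^ i)%:R <= D ^+ i.
Proof. by rewrite natrX lerXn2r // nnegrE ltW. Qed.

Lemma err_ratio : 132 <= err ^+ 2 * ratio%:R.
Proof.
have -> : err ^+ 2 * ratio%:R = D ^+ 8.
  rewrite /ratio natrX exprD mulrA mulnC exprM -exprMn mulVf ?expr1n ?mul1r //.
  by rewrite gt_eqF.
apply: le_trans (pow2_le 8); rewrite ler_nat.
by [].
Qed.

Lemma err_sum_lt (n_gt0 : (0 < n)%N) :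
  n%:R * (err + 16 / ratio%:R + (4 * ratio%:R ^+ 10) ^+ n.-1 / scale_count%:R)
    < ((D ^+ 4)^-1) ^+ (2 ^ n).
Proof.
set q := err_exponent.
have nD : n%:R <= D ^+ n by apply: le_trans (pow2_le n); rewrite ler_nat ltnW // ltn_expl.
have rhsE : ((D ^+ 4)^-1) ^+ (2 ^ n) = D ^+ n * D ^+ 2 / D ^+ q.
  have -> : D ^+ q = D ^+ n * D ^+ 2 * D ^+ (4 * 2 ^ n) by rewrite -!exprD.
  by rewrite exprVn -exprM; field; rewrite !gt_eqF.
pose E := D ^+ n / D ^+ q.
have kE : ratio%:R = D ^+ (2 * q + 8) by rewrite natrX.
have mono i j : (i <= j)%N -> D ^+ i <= D ^+ j.
  by move=> ij; apply: ler_weXn2l => //; apply: le_trans D2; rewrite ler1n.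
have t1 : n%:R * err <= E by rewrite /E ler_pM2r // invr_gt0.
have t2 : n%:R * (16 / ratio%:R) <= E.
  rewrite mulrA ler_pdivrMr ?kE // /E.
  have -> : D ^+ n / D ^+ q * D ^+ (2 * q + 8) = D ^+ n * D ^+ (q + 8).
    rewrite (_ : (2 * q + 8 = q + (q + 8))%N); last by lia.
    by rewrite (exprD D q) mulrA divfK // gt_eqF.
  apply: ler_pM => //; apply: le_trans (pow2_le 4) (mono _ _ _); lia.
have t3 : n%:R * ((4 * ratio%:R ^+ 10) ^+ n.-1 / scale_count%:R) <= E.
  have b1 : 4 * ratio%:R ^+ 10 <= D ^+ (20 * q + 82).
    rewrite kE -exprM (_ : (20 * q + 82 = 2 + (2 * q + 8) * 10)%N); last by lia.
    by rewrite exprD ler_pM2r //; apply: (pow2_le 2).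
  have b2 : (4 * ratio%:R ^+ 10) ^+ n.-1 <= D ^+ ((20 * q + 82) * n).
    apply: le_trans (_ : D ^+ (20 * q + 82) ^+ n.-1 <= _).
      by rewrite lerXn2r // nnegrE ?mulr_ge0 ?exprn_ge0 // ltW.
    rewrite -exprM; apply: mono; rewrite leq_mul2l leq_pred orbT.
    by [].
  rewrite mulrA ler_pdivrMr; last by rewrite /scale_count natrX.
  rewrite /scale_count natrX -/D.
  have -> : E * D ^+ scale_exponent = D ^+ n * D ^+ ((20 * q + 82) * n).
    by rewrite /E /scale_exponent -/q exprD; field; rewrite gt_eqF.
  by apply: ler_pM => //; rewrite exprn_ge0 // mulr_ge0 // exprn_ge0.
rewrite rhsE mulrAC -/E !mulrDr.
have E0 : 0 < E by rewrite divr_gt0.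
have D4 : E * 4 <= E * D ^+ 2 by rewrite ler_pM2l //; apply: (pow2_le 2).
lra.
Qed.

(** The leading 1 comes from [d <= expR d]. The rest bounds the exponent of [d] in
    [ratio ^ (8 * scale_count)], its constant factor [c] being estimated by [d ^ c]. *)
Definition length_exponent : nat := (1 + ((2 * err_exponent + 8) * 8 + scale_exponent))%N.

Lemma ratio_pow_le_exp : (ratio ^ (8 * scale_count))%:R <= expR (D ^+ length_exponent).
Proof.
set M := ((2 * err_exponent + 8) * (8 * scale_count))%N.
rewrite /ratio -expnM -/M natrX -/D.
have h1 : D <= expR D by apply: le_trans (expR_ge1Dx D); rewrite lerDr.
apply: le_trans (_ : expR D ^+ M <= _).
  by rewrite lerXn2r // nnegrE ?expR_ge0 // ltW.
rewrite -expRM_natl ler_expR /length_exponent exprD expr1 mulrC ler_pM2l //.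
rewrite exprD /M mulnA natrM /scale_count natrX ler_pM2r //.
by apply: le_trans (pow2_le _); rewrite ler_nat ltnW // ltn_expl.
Qed.

End parameters.

(** The stable scale may vary with the mesh; an ultrafilter retains a single one of its finitely
    many values. *)
Lemma ultra_finite_partition (T : Type) (U : set_system T) (J : nat) (f : T -> nat) :
  UltraFilter U -> (forall x, (f x < J)%N) -> exists2 j, (j < J)%N & U [set x | f x = j].
Proof.
move=> UU fJ; apply: contrapT => /forall2NP nU.
have Un j : (j < J)%N -> U [set x | f x != j].
  move=> jJ; have [//|nUj] := nU j.
  have [//|] := in_ultra_setVsetC [set x | f x = j] UU.
  by apply: filterS => x /= h; apply/eqP.
have : U [set x | forall j : 'I_J, f x != j].
  by apply: filter_forall => j; exact: Un.
move=> /filter_ex[x /(_ (Ordinal (fJ x)))] /=.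
by rewrite eqxx.
Qed.

Lemma expn_split (k a b c e m : nat) : a = (b + (c + e))%N ->
  (k ^ a * m = k ^ b * (k ^ c * (k ^ e * m)))%N.
Proof. by move=> ->; rewrite !expnD !mulnA. Qed.

Lemma subset_hypercube_graph (R : realType) n (lambda : R) (A B : set (R * R)) :
  A `<=` B -> contains_hypercube_graph n lambda A -> contains_hypercube_graph n lambda B.
Proof. by move=> AB [x [y [h1 h2 h3]]]; exists x, y; split=> // r; apply/AB/h2. Qed.

(** [Q m] and [b] are both proportional to [m.+1], so that [k ^ 7 * b] over [Q m] is
    [k ^ (- (8 * j + 1))] at every mesh; likewise [tau] is [k ^ 5 * b] over [Q m]. *)
Lemma exists_scale_hypercubes (R : realType) (n d : nat) (K : set (R * R)) :
  (0 < n)%N -> (2 <= d)%N -> closed K ->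
  measurable (K : set (measurableTypeR R * measurableTypeR R)) ->
  K `<=` rectangle 0 1 0 1 ->
  ((4 / d%:R ^+ 4)%:E <= (@lebesgue_measure R \x @lebesgue_measure R) K)%E ->
  exists2 j, (j < scale_count n d)%N &
    forall lambda : R, let k : R := (ratio n d)%:R in
      (k ^+ (8 * j + 1))^-1 <= lambda <= 2 * (k ^+ (8 * j + 1))^-1 ->
      contains_hypercube_graph n lambda K.
Proof.
move=> n0 d2 cK mK K1 dK.
set k := ratio n d; set J := scale_count n d.
have [k8 k4n k3n] := ratio_ge n d2; rewrite -/k in k8 k4n k3n.
have k0 : (0 < k)%N by apply: leq_trans k8.
have kp i : (0 < k ^ i)%N by rewrite expn_gt0 k0.
have kR : 0 < k%:R :> R by rewrite ltr0n.
have kRp i : 0 < k%:R ^+ i :> R by rewrite exprn_gt0.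
have J0 : (0 < J)%N by rewrite /J /scale_count expn_gt0 (leq_trans _ d2).
have dR : 0 < d%:R :> R by rewrite ltr0n (leq_trans _ d2).
pose Q (m : nat) := (k ^ (8 * J) * m.+1)%N.
have Qpos m : (0 < Q m)%N by rewrite muln_gt0 kp.
have QR m : 0 < (Q m)%:R :> R by rewrite ltr0n.
have SQ m i j : meets_cell K (Q m) i j -> (i < Q m)%N && (j < Q m)%N.
  by move=> /and3P[-> ->].
have big m : n%:R * (err n d + 16 / k%:R + (4 * k%:R ^+ 10) ^+ n.-1 / J%:R)
    < ((\sum_(i < 2 * Q m) \sum_(j < 2 * Q m) (meets_cell K (Q m) i j)%:R)
        / (2 * Q m)%:R ^+ 2) ^+ (2 ^ n) :> R.
  apply: lt_le_trans (err_sum_lt d2 n0) _.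
  have h := le_trans dK (lebesgue_le_cells (Qpos m) (leq_pmull (Q m) (isT : 0 < 2)%N) mK K1).
  rewrite lee_fin in h.
  set S := \sum_(i < _) _ in h *.
  (* The torus has four times the area of the unit square, whence the 4 in the hypothesis on [K]. *)
  have h' : (d%:R ^+ 4)^-1 <= S / (2 * Q m)%:R ^+ 2.
    rewrite natrM exprMn invfM mulrA mulrAC; lra.
  by rewrite lerXn2r // nnegrE ?invr_ge0 ?exprn_ge0 ?ler0n //; apply: le_trans h'; rewrite invr_ge0 exprn_ge0 // ltW.
have /choice[jm jmP] : forall m, exists j, (j < J)%N /\ let b := (k ^ (8 * (J - j.+1)) * m.+1)%N in
    forall L : R, (k ^ 7 * b)%:R <= L <= 2 * (k ^ 7 * b)%:R ->
    exists x y : nat, exists t v : nat -> nat,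
    [/\ forall i, (i < n)%N -> (4 ^ i.+1 * (k ^ 5 * b) <= t i <= (4 ^ i.+1).+1 * (k ^ 5 * b))%N,
        forall i, (i < n)%N -> `|(v i)%:R - circle_height L (t i)%:R| <= k%:R
      & forall r : nat -> bool,
          meets_cell K (Q m) (x + \sum_(i < n) t i * r i)%N (y + \sum_(i < n) v i * r i)%N].
  move=> m.
  have [j jJ hj] := discrete_hypercubes k8 k4n k3n (ltn0Sn m) J0 (err_gt0 n d2) (err_ratio n d2) (@SQ m) (big m).
  by exists j.
have [U [UU sU]] := ultraFilterLemma eventually_filter.
have [j jJ Uj] := ultra_finite_partition UU (fun m => (jmP m).1).
exists j => // lambda kk /andP[l1 l2].
pose tau : R := (k%:R ^+ (8 * j + 3))^-1.
have tau0 : 0 < tau by rewrite invr_gt0.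
have tauE : (k%:R ^+ (8 * j + 1))^-1 = k%:R ^+ 2 * tau.
  have -> : tau = (k%:R ^+ 2)^-1 * (k%:R ^+ (8 * j + 1))^-1.
    by rewrite /tau -invfM -exprD; congr (_ ^+ _)^-1; clear; lia.
  by rewrite mulrA mulfV ?mul1r // gt_eqF.
have bE m : (Q m)%:R = k%:R ^+ (8 * j + 3) * (k ^ 5 * (k ^ (8 * (J - j.+1)) * m.+1))%:R :> R.
  rewrite -natrX -natrM; congr _%:R; apply: expn_split; move: jJ; clear; lia.
have bE7 m : (k ^ 7 * (k ^ (8 * (J - j.+1)) * m.+1))%:R = (k%:R ^+ (8 * j + 1))^-1 * (Q m)%:R :> R.
  rewrite bE tauE /tau -mulrA mulKf ?gt_eqF // -natrX -natrM; congr _%:R.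
  by rewrite (expnD k 2 5) -mulnA.
apply: (@limit_hypercube R K n U Q lambda tau k%:R) => //.
- have hU : harmonic @ U --> (0 : R) by apply: cvg_trans cvg_harmonic; exact: cvg_app.
  rewrite (_ : (fun m => _) = (fun m => (k ^ (8 * J))%:R^-1 * harmonic m)).
    by rewrite -[X in _ --> X](mulr0 (k ^ (8 * J))%:R^-1); exact: cvgMl_tmp.
  by apply/funext => m; rewrite /Q natrM invfM.
- by apply: lt_le_trans l1; rewrite invr_gt0.
- apply: le_trans l1; rewrite tauE ler_pM2r //.
  apply: (@le_trans _ _ k%:R).
    rewrite ler_nat; apply: leq_trans k4n; rewrite expnS.
    have : (0 < 4 ^ n)%N by rewrite expn_gt0.
    lia.
  by rewrite expr2 ler_peMl ?ler0n // ler1n.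
apply: filterS Uj => m /= jmj.
have [_ hj] := jmP m; rewrite jmj /= in hj.
have [|x [y [t [v [h1 h2 h3]]]]] := hj (lambda * (Q m)%:R).
  by rewrite bE7 mulrA !ler_pM2r // l1.
exists x, y, t, v; split=> // i iN.
have /andP[a1 a2] := h1 i iN.
rewrite ler_pdivlMr // ler_pdivrMr // bE /tau -!mulrA !mulKf ?gt_eqF // -!natrM !ler_nat.
by rewrite a1.
Qed.

Theorem theorem2 (R : realType) (n : nat) (n_gt0 : (0 < n)%N) :
  exists2 C : R, 0 < C &
    forall (delta : R) (A : set (R * R)),
      0 < delta -> delta <= 1 / 2 ->
      lebesgue_measurable2 A ->
      A `<=` `[0, 1] `*` `[0, 1] ->
      (delta%:E <= lebesgue_measure2 A)%E ->
      exists I : interval R,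
        [/\ [set` I] `<=` `]0, 1],
            ((expR (- (delta `^ (- C))))%:E <= lebesgue_measure [set` I])%E
          & forall lambda : R, lambda \in I ->
              contains_hypercube_graph n lambda A].
Proof.
(* The exponent is doubled because the integer [d] replacing [delta^-1] is only bounded by
   [delta^-1 ^+ 2]. *)
pose r := length_exponent n.
exists (2 * r)%:R.
  by rewrite ltr0n muln_gt0.
move=> delta A d0 d1 mA A1 dA.
have [K [cK mK KA dK]] := closed_subset_lebesgue d0 mA A1 dA.
have id0 : 0 < delta^-1 by rewrite invr_gt0.
have id2 : 2 <= delta^-1.
  by rewrite -[2]invrK lef_pV2 ?posrE //; lra.
pose d := (Num.truncn (delta^-1)).+1.
have dlt : delta^-1 < d%:R by exact: truncnS_gt.
have dle : d%:R <= delta^-1 ^+ 2.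
  have h : (Num.truncn (delta^-1))%:R <= delta^-1 by rewrite truncn_le ltW.
  rewrite /d -natr1 expr2; have : 2 * delta^-1 <= delta^-1 * delta^-1 by rewrite ler_pM2r.
  lra.
have d2 : (2 <= d)%N by rewrite -(ler_nat R) ltW // (le_lt_trans id2).
have dR : 2 <= d%:R :> R by rewrite ler_nat.
(* From [delta >= 1 / d] and [d ^ 3 >= 8], one gets [delta / 2 >= 1 / (2 * d) >= 4 / d ^ 4]. *)
have dK' : ((4 / d%:R ^+ 4)%:E <= (@lebesgue_measure R \x @lebesgue_measure R) K)%E.
  apply: le_trans dK; rewrite lee_fin.
  have h1 : d%:R^-1 <= delta by rewrite -[leRHS]invrK lef_pV2 ?posrE ?ltW // ltr0n.
  apply: (@le_trans _ _ (d%:R^-1 / 2)); last by rewrite ler_pM2r.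
  have dp : 0 < d%:R :> R by rewrite ltr0n.
  rewrite ler_pdivrMr ?exprn_gt0 //.
  have -> : d%:R^-1 / 2 * d%:R ^+ 4 = d%:R ^+ 3 / 2 :> R by field; rewrite gt_eqF.
  have : 2 ^+ 3 <= d%:R ^+ 3 :> R by rewrite lerXn2r ?nnegrE.
  lra.
have KI : K `<=` rectangle 0 1 0 1 by move=> x /KA; exact: A1.
have [j jJ hj] := exists_scale_hypercubes n_gt0 d2 cK mK KI dK'.
set k : R := (ratio n d)%:R in hj.
have [k8 _ _] := ratio_ge n d2.
have k0 : 2 <= k by rewrite ler_nat; apply: leq_trans k8.
have k00 : 0 < k by lra.
have k1 : 1 <= k by lra.
have kp i : 0 < k ^+ i by rewrite exprn_gt0.
pose l := (k ^+ (8 * j + 1))^-1.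
have l0 : 0 < l by rewrite invr_gt0.
exists `[l, 2 * l]; split.
- move=> x /=; rewrite !in_itv /= => /andP[x1 x2]; apply/andP; split.
    exact: lt_le_trans x1.
  apply: le_trans x2 _; rewrite ler_pdivrMr // mul1r.
  rewrite addn1 exprS; apply: le_trans k0 _.
  by apply: ler_peMr; [exact: ltW|exact: exprn_ege1].
- rewrite lebesgue_measure_itv /= lte_fin ltr_pMl // ?ltr1n // -EFinB lee_fin.
  have -> : 2 * l - l = l by ring.
  have h := @ratio_pow_le_exp R n d d2.
  apply: (@le_trans _ _ (expR (d%:R ^+ r))^-1).
    rewrite -expRN ler_expR lerN2.
    have -> : delta `^ (- (2 * r)%:R) = (delta^-1 ^+ 2) ^+ r.
      by rewrite powRN powR_mulrn ?ltW // -exprM exprVn.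
    by rewrite lerXn2r // nnegrE ?ler0n // exprn_ge0 // ltW.
  rewrite lef_pV2 ?posrE ?expR_gt0 //.
  apply: le_trans h; rewrite natrX -/k; apply: ler_weXn2l => //.
  apply: (@leq_trans (8 * j.+1)); last by rewrite leq_mul2l jJ.
  by rewrite mulnS addnC leq_add2r.
move=> lambda; rewrite in_itv /= => lI.
by apply: (subset_hypercube_graph KA); exact: hj.
Qed.
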